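(* Let $T$ be an affine theory and let $x$ be a tuple of variables (of arbitrary length). Then a type $p\in S^{\mathrm{aff}}_x(T)$ is an extreme point of $S^{\mathrm{aff}}_x(T)$ if and only if $p$ is realized by some tuple in some extremal model of $T$. In other words, $\mathcal{E}_x(T)$ is exactly the set of affine types of $x$-tuples realized in extremal models of $T$.
   Context: Affine logic: a signature $\mathcal L$ has function and predicate symbols with arities, each predicate symbol having a compact value interval, each symbol having a continuity modulus (a convex function $\delta:[0,\infty)\to[0,\infty)$ with $\delta(\varepsilon)=0$ iff $\varepsilon=0$), and a distinguished binary distance predicate $d$. An $\mathcal L$-structure is a non-empty complete metric space with interpretations of the symbols respecting the value intervals and continuity moduli (as in continuous logic), $d$ being interpreted as the metric. Affine formulas are built from atomic formulas by real affine combinations (including the constant $1$) and the quantifiers $\sup_y,\inf_y$. An affine theory is a set of conditions $\varphi\ge\psi$ with $\varphi,\psi$ affine sentences. For a model $M$ of $T$ and $a\in M^x$, the affine type $\mathrm{tp}^{\mathrm{aff}}(a)$ is the function $\varphi(x)\mapsto\varphi^M(a)$ on affine formulas; $S^{\mathrm{aff}}_x(T)$ is the set of all such types (over all models of $T$), with the topology of pointwise convergence and the pointwise convex structure; it is a compact convex set. $\mathcal E_x(T)$ denotes its set of extreme points (extreme types). A model $M$ of $T$ is extremal if for every $n\in\mathbb N$ and every $a\in M^n$, $\mathrm{tp}^{\mathrm{aff}}(a)\in\mathcal E_n(T)$. *)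

(* Defs.v *)
(* Affine (continuous) logic over MathComp-Analysis. *)
From mathcomp Require Import all_boot all_order all_algebra.
From mathcomp Require Import all_classical all_reals all_analysis.
Import Order.TTheory GRing.Theory Num.Theory.
Import numFieldNormedType.Exports.

Set Implicit Arguments.
Unset Strict Implicit.
Unset Printing Implicit Defensive.

Local Open Scope classical_set_scope.
Local Open Scope ring_scope.

(* Only the restriction of [modulus_fun] to [0, +oo[ is meaningful. *)
Record modulus (R : realType) := Modulus {
  modulus_fun :> R -> R;
  modulus_ge0 : forall e : R, 0 <= e -> 0 <= modulus_fun e;
  modulus_eq0 : forall e : R, 0 <= e -> (modulus_fun e = 0 <-> e = 0);
  modulus_convex : convex_function (`[0, +oo[%classic : set R^o) modulus_fun
}.

(* The convention of continuous logic for "f respects delta".  Tuples carry the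
   sum metric: this, together with convexity of moduli, is what makes the type
   spaces of affine theories convex (the max metric would not). *)
Definition respects (R : realType) (delta : modulus R) (n : nat)
    (M N : metricType R) (f : ('I_n -> M) -> N) : Prop :=
  forall (e : R) (a b : 'I_n -> M), 0 < e ->
    \sum_(i < n) mdist (a i) (b i) < delta e -> mdist (f a) (f b) <= e.

(* The distance symbol is kept apart from [psym], so that its arity is 2 and its
   interpretation is the metric by construction; like any predicate symbol it
   has its own value interval and modulus. *)
Record signature (R : realType) := Signature {
  fsym : Type;
  fsym_arity : fsym -> nat;
  fsym_modulus : fsym -> modulus R;
  psym : Type;
  psym_arity : psym -> nat;
  psym_modulus : psym -> modulus R;
  psym_lo : psym -> R;
  psym_hi : psym -> R;
  psym_lo_hi : forall P, psym_lo P <= psym_hi P;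
  dist_modulus : modulus R;
  dist_lo : R;
  dist_hi : R;
  dist_lo_hi : dist_lo <= dist_hi
}.

(* Completeness is spelled out because the library's complete spaces carry a
   distinguished point. *)
Record structure (R : realType) (L : signature R) := Structure {
  carrier :> metricType R;
  carrier_nonempty : [set: carrier] !=set0;
  carrier_complete : forall F : set_system carrier,
    ProperFilter F -> cauchy F -> exists a : carrier, F --> a;
  fun_interp : forall f : fsym L, ('I_(fsym_arity f) -> carrier) -> carrier;
  fun_respects : forall f : fsym L,
    respects (fsym_modulus f) (@fun_interp f);
  pred_interp : forall P : psym L, ('I_(psym_arity P) -> carrier) -> R;
  pred_bounds : forall (P : psym L) (a : 'I_(psym_arity P) -> carrier),
    psym_lo P <= pred_interp a <= psym_hi P;
  pred_respects : forall P : psym L,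
    respects (psym_modulus P) (@pred_interp P : _ -> R^o);
  dist_bounds : forall a b : carrier, dist_lo L <= mdist a b <= dist_hi L;
  dist_respects : respects (dist_modulus L)
    ((fun a => mdist (a ord0) (a ord_max)) : ('I_2 -> carrier) -> R^o)
}.

Inductive term (R : realType) (L : signature R) (X : Type) : Type :=
| Var of X
| App (f : fsym L) of 'I_(fsym_arity f) -> term L X.

(* Affine formulas with free variables in X.  A quantifier binds the variable
   [None] of a formula over [option X]. *)
Inductive formula (R : realType) (L : signature R) (X : Type) : Type :=
| Pred (P : psym L) of 'I_(psym_arity P) -> term L X
| Dist of term L X & term L X
| One
| Add of formula L X & formula L X
| Scale of R & formula L X
| Sup of formula L (option X)
| Inf of formula L (option X).

Fixpoint term_eval (R : realType) (L : signature R) (M : structure L)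
    (X : Type) (a : X -> M) (t : term L X) : M :=
  match t with
  | Var x => a x
  | App f ts => fun_interp (fun i => term_eval a (ts i))
  end.

Fixpoint eval (R : realType) (L : signature R) (M : structure L)
    (X : Type) (a : X -> M) (phi : formula L X) : R :=
  match phi with
  | Pred P ts => pred_interp (fun i => term_eval a (ts i))
  | Dist s t => mdist (term_eval a s) (term_eval a t)
  | One => 1
  | Add phi1 phi2 => eval a phi1 + eval a phi2
  | Scale c phi1 => c * eval a phi1
  | Sup phi1 => sup (range (fun b : M => eval (oapp a b) phi1))
  | Inf phi1 => inf (range (fun b : M => eval (oapp a b) phi1))
  end.

Definition sentence (R : realType) (L : signature R) := formula L void.

(* The pair (phi, psi) stands for the condition phi >= psi. *)
Definition theory (R : realType) (L : signature R) :=
  set (sentence L * sentence L).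

Definition models (R : realType) (L : signature R) (M : structure L)
    (T : theory L) : Prop :=
  forall phi psi : sentence L, T (phi, psi) ->
    eval (of_void M) phi >= eval (of_void M) psi.

(* [R^o] gives functions on formulas their pointwise vector space structure. *)
Definition aff_type (R : realType) (L : signature R) (M : structure L)
    (X : Type) (a : X -> M) : formula L X -> R^o :=
  fun phi => eval a phi.

Definition type_space (R : realType) (L : signature R) (T : theory L)
    (X : Type) : set (formula L X -> R^o) :=
  [set p | exists M : structure L, models M T /\
           exists a : X -> M, p = aff_type a].
Arguments type_space {R L} T X _.

Definition extreme_points (R : realType) (E : lmodType R) (K : set E) : set E :=
  [set p | K p /\
    forall (q r : E) (t : R), K q -> K r -> 0 < t < 1 ->
      p = t *: q + (1 - t) *: r -> q = p /\ r = p].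

Definition extreme_types (R : realType) (L : signature R) (T : theory L)
    (X : Type) : set (formula L X -> R^o) :=
  extreme_points (type_space T X).
Arguments extreme_types {R L} T X _.

Definition extremal_model (R : realType) (L : signature R) (T : theory L)
    (M : structure L) : Prop :=
  models M T /\
  forall (n : nat) (a : 'I_n -> M), extreme_types T 'I_n (aff_type a).

(* Main.v *)
From HB Require Import structures.
From Stdlib Require List.
Require Import Defs.
From mathcomp Require Import all_boot all_order all_algebra.
From mathcomp Require Import all_classical all_reals all_analysis.
From mathcomp Require Import ring lra.
Import Order.TTheory GRing.Theory Num.Theory.
Import numFieldNormedType.Exports.

Set Implicit Arguments.
Unset Strict Implicit.
Unset Printing Implicit Defensive.

Local Open Scope classical_set_scope.
Local Open Scope ring_scope.

(* Enlarge the variables X by Henkin witnesses.  A "Henkin state" is a normalized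
   linear functional on formulas in these variables that is monotone for
   consequence modulo T and gives every supremum the value at its witness; all
   these conditions are affine and closed, and a Henkin state is the type of a
   tuple that generates, by terms and completion, a model of T.  Henkin states
   thus form a compact convex set whose restriction to X is the type space, which
   is therefore compact and convex.
   Given an extreme type p, the Henkin states extending p form a closed face, so
   that one of them, q, is extreme; the model M generated by q realizes p by a
   part of the generating tuple c.  If a finite tuple a of M has a type
   t u + (1 - t) v, then a separation argument, in which suprema over fibers are
   expressed by quantifiers, lifts this to a decomposition of the type of (a, c).
   Its restrictions to c are Henkin states and so are both q; and q determines the
   type of (a, c), because a is a limit of terms in c.  Hence u = v. *)

(** An affine map need not send extreme points to extreme points, and a limit of extreme points need
    not be extreme. Both facts obstruct the passage from q to a finite tuple a of M, whose entries
    are only limits of terms in c. This is why a decomposition of the type of a has to be lifted to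
    (a, c) before it can be compared with q. Such a lifting fails for a general affine surjection of
    compact convex sets, where the supremum of an affine function over a fiber is only concave in
    the base point. Here a single formula computes this supremum over all fibers at once, which
    makes it affine. Witnesses can be exact although suprema need not be attained in a given model:
    exactness is gained in a limit of approximate witnesses, at the price of changing the model. *)

(* The library of topology has its own [eval]. *)
Local Notation eval := Defs.eval.

(** * Syntax *)

Section Syntax.
Context {R : realType} {L : signature R}.

Fixpoint tsubst (X Y : Type) (s : X -> term L Y) (t : term L X) : term L Y :=
  match t with
  | Var x => s x
  | App f ts => @App R L Y f (fun i => tsubst s (ts i))
  end.

Definition slift (X Y : Type) (s : X -> term L Y) (o : option X) :
    term L (option Y) :=
  if o is Some x then tsubst (fun y => Var L (Some y)) (s x) else Var L None.

Fixpoint subst (X Y : Type) (s : X -> term L Y) (phi : formula L X) :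
    formula L Y :=
  match phi with
  | Pred P ts => @Pred R L Y P (fun i => tsubst s (ts i))
  | Dist t u => Dist (tsubst s t) (tsubst s u)
  | One => One L Y
  | Add p1 p2 => Add (subst s p1) (subst s p2)
  | Scale c p1 => Scale c (subst s p1)
  | Sup p1 => Sup (subst (slift s) p1)
  | Inf p1 => Inf (subst (slift s) p1)
  end.

Definition rename (X Y : Type) (r : X -> Y) : formula L X -> formula L Y :=
  subst (fun x => Var L (r x)).

Lemma term_eval_tsubst (M : structure L) (X Y : Type) (a : Y -> M)
    (s : X -> term L Y) (t : term L X) :
  term_eval a (tsubst s t) = term_eval (term_eval a \o s) t.
Proof.
by elim: t => //= f ts IH; congr fun_interp; apply/funext => i; exact: IH.
Qed.

Lemma term_eval_slift (M : structure L) (X Y : Type) (a : Y -> M) (b : M)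
    (s : X -> term L Y) :
  term_eval (oapp a b) \o slift s = oapp (term_eval a \o s) b.
Proof. by apply/funext => -[x|] //=; rewrite term_eval_tsubst. Qed.

Lemma eval_subst (M : structure L) (X Y : Type) (a : Y -> M)
    (s : X -> term L Y) (phi : formula L X) :
  eval a (subst s phi) = eval (term_eval a \o s) phi.
Proof.
elim: phi Y a s => {X} /=.
- move=> X P ts Y a s; congr pred_interp; apply/funext => i.
  exact: term_eval_tsubst.
- by move=> X t u Y a s; rewrite !term_eval_tsubst.
- by [].
- by move=> X p1 IH1 p2 IH2 Y a s; rewrite IH1 IH2.
- by move=> X c p1 IH Y a s; rewrite IH.
- move=> X p1 IH Y a s; congr sup; congr image; apply/funext => b.
  by rewrite IH term_eval_slift.
- move=> X p1 IH Y a s; congr inf; congr image; apply/funext => b.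
  by rewrite IH term_eval_slift.
Qed.

Lemma eval_rename (M : structure L) (X Y : Type) (a : Y -> M) (r : X -> Y)
    (phi : formula L X) : eval a (rename r phi) = eval (a \o r) phi.
Proof. exact: eval_subst. Qed.

Lemma tsubst_tsubst (X Y Z : Type) (r : Y -> term L Z) (s : X -> term L Y)
    (t : term L X) : tsubst r (tsubst s t) = tsubst (tsubst r \o s) t.
Proof.
by elim: t => //= f ts IH; congr App; apply/funext => i; exact: IH.
Qed.

Lemma slift_Var (X Y : Type) (r : X -> Y) :
  slift (fun x => Var L (r x)) = fun o => Var L (omap r o).
Proof. by apply/funext => -[]. Qed.

Lemma rename_comp (X Y Z : Type) (r : Y -> Z) (s : X -> Y)
    (phi : formula L X) : rename r (rename s phi) = rename (r \o s) phi.
Proof.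
rewrite /rename; elim: phi Y Z r s => {X} /=.
- move=> X P ts Y Z r s; congr Pred; apply/funext => i; exact: tsubst_tsubst.
- by move=> X t u Y Z r s; rewrite !tsubst_tsubst.
- by [].
- by move=> X p1 IH1 p2 IH2 Y Z r s; rewrite IH1 IH2.
- by move=> X c p1 IH Y Z r s; rewrite IH.
- move=> X p1 IH Y Z r s; rewrite !slift_Var IH.
  by congr Sup; congr subst; apply/funext => -[].
- move=> X p1 IH Y Z r s; rewrite !slift_Var IH.
  by congr Inf; congr subst; apply/funext => -[].
Qed.

Lemma term_finite_support (X : Type) (t : term L X) :
  exists (F : finType) (r : F -> X) (t0 : term L F),
    t = tsubst (fun x => Var L (r x)) t0.
Proof.
elim: t => [x|f ts IH].
  by exists unit, (fun=> x), (Var L tt).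
pose F i := projT1 (cid (IH i)).
have H i : {r : F i -> X & {t0 | ts i = tsubst (fun x => Var L (r x)) t0}}.
  have [r Hr] := cid (projT2 (cid (IH i))).
  by exists r; have [t0 e] := cid Hr; exists t0.
exists {i : 'I_(fsym_arity f) & F i}.
exists (fun j => projT1 (H (tag j)) (tagged j)).
exists (App (fun i => tsubst (fun x => Var L (Tagged F x))
  (sval (projT2 (H i))))) => /=.
congr App; apply/funext => i; rewrite tsubst_tsubst.
exact: (svalP (projT2 (H i))).
Qed.

(** For passing under a quantifier: the part of the support sent to the bound variable [None] is
    split off, and what remains supports the quantified formula. *)
Lemma option_support (F : finType) (X : Type) (r : F -> option X) :
  exists (F' : finType) (r' : F' -> X) (g : F -> option F'),
    r = omap r' \o g.
Proof.
pose F' := {i : F | isSome (r i)}.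
have get (i : F') : {x | r (val i) = Some x}.
  by case: i => i /=; case: (r i) => // x _; exists x.
exists F', (fun i => sval (get i)), (fun i => insub i).
apply/funext => i /=; case: insubP => [u _ <-|]; first exact: (svalP (get u)).
by case: (r i).
Qed.

(** Contexts are arbitrary finite types here, so that the induction can use sums and dependent sums
    of supports; ordinals come back afterwards through [enum_rank]. *)
Lemma formula_finite_support_finType (X : Type) (phi : formula L X) :
  exists (F : finType) (r : F -> X) (phi0 : formula L F), phi = rename r phi0.
Proof.
rewrite /rename; elim: phi => {X}.
- move=> X P ts.
  pose F i := projT1 (cid (term_finite_support (ts i))).
  have H i : {r : F i -> X & {t0 | ts i = tsubst (fun x => Var L (r x)) t0}}.
    have [r Hr] := cid (projT2 (cid (term_finite_support (ts i)))).
    by exists r; have [t0 e] := cid Hr; exists t0.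
  exists {i : 'I_(psym_arity P) & F i}.
  exists (fun j => projT1 (H (tag j)) (tagged j)).
  exists (Pred (fun i => tsubst (fun x => Var L (Tagged F x))
    (sval (projT2 (H i))))) => /=.
  congr Pred; apply/funext => i; rewrite tsubst_tsubst.
  exact: (svalP (projT2 (H i))).
- move=> X t u.
  have [F [r [t0 ->]]] := term_finite_support t.
  have [G [s [u0 ->]]] := term_finite_support u.
  exists (F + G)%type, (fun j => match j with inl i => r i | inr i => s i end).
  exists (Dist (tsubst (fun i => Var L (inl i)) t0)
               (tsubst (fun i => Var L (inr i)) u0)) => /=.
  by rewrite !tsubst_tsubst.
- by move=> X; exists void, (of_void X), (One L void).
- move=> X p1 [F [r [q1 ->]]] p2 [G [s [q2 ->]]].
  pose rs j := match j with inl i => r i | inr i => s i end.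
  exists (F + G)%type, rs, (Add (rename inl q1) (rename inr q2)) => /=.
  by rewrite -!/(rename rs _) !rename_comp.
- by move=> X c p1 [F [r [q1 ->]]]; exists F, r, (Scale c q1).
- move=> X p1 [F [r [q1 ->]]].
  have [F' [r' [g rE]]] := option_support r.
  exists F', r', (Sup (rename g q1)) => /=.
  by rewrite slift_Var -!/(rename _ _) rename_comp rE.
- move=> X p1 [F [r [q1 ->]]].
  have [F' [r' [g rE]]] := option_support r.
  exists F', r', (Inf (rename g q1)) => /=.
  by rewrite slift_Var -!/(rename _ _) rename_comp rE.
Qed.

Lemma formula_finite_support (X : Type) (phi : formula L X) :
  exists (n : nat) (r : 'I_n -> X) (phi0 : formula L 'I_n),
    phi = rename r phi0.
Proof.
have [F [r [phi0 ->]]] := formula_finite_support_finType phi.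
exists #|F|, (r \o enum_val), (rename enum_rank phi0).
rewrite rename_comp; congr rename.
by apply/funext => i /=; rewrite enum_rankK.
Qed.

(** Puts the body of a quantifier into the shape that [HWit] expects: a bound variable kept apart
    from finitely many parameters. *)
Lemma body_finite_support (X : Type) (phi : formula L (option X)) :
  exists (n : nat) (r : 'I_n -> X) (phi0 : formula L (option 'I_n)),
    phi = rename (omap r) phi0.
Proof.
have [F [r [phi0 ->]]] := formula_finite_support_finType phi.
have [F' [r' [g ->]]] := option_support r.
exists #|F'|, (r' \o enum_val), (rename (omap enum_rank \o g) phi0).
rewrite rename_comp; congr rename.
by apply/funext => i /=; case: (g i) => //= j; rewrite enum_rankK.
Qed.

End Syntax.

(** * Semantics *)

Section Metric.
Context {R : realType} {M : metricType R}.
Implicit Types x y z : M.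

Lemma mdist_sym x y : mdist x y = mdist y x.
Proof. exact: metric_sym. Qed.

Lemma mdist_tri x y z : mdist x z <= mdist x y + mdist y z.
Proof. exact: metric_triangle. Qed.

End Metric.

Section BoundedSup.
Context {R : realType}.

Lemma mdist_realE (x y : R^o) : mdist x y = `|x - y|.
Proof. by rewrite distrC. Qed.

Lemma lowers_pos (k : nat) (d : 'I_k -> R) :
  (forall i, 0 < d i) -> exists2 m, 0 < m & forall i, m <= d i.
Proof.
move=> d0; exists (\big[Order.Def.min/1]_i d i); last by move=> i; exact: bigmin_le.
by apply: lt_bigmin.
Qed.

Lemma minl_le (r s : R) : Num.min r s <= r.
Proof. by rewrite ge_min lexx. Qed.

Lemma minr_le (r s : R) : Num.min r s <= s.
Proof. by rewrite ge_min lexx orbT. Qed.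

Context {T : Type} (t0 : T) (f : T -> R) (B : R).
Hypothesis fB : forall t, `|f t| <= B.

Lemma bounded_le_sup t : f t <= sup (range f).
Proof.
apply: ub_le_sup; last by exists t.
by exists B => _ [u _ <-]; exact: le_trans (ler_norm _) (fB u).
Qed.

Lemma bounded_ge_inf t : inf (range f) <= f t.
Proof.
apply: ge_inf; last by exists t.
by exists (- B) => _ [u _ <-]; have := fB u; rewrite ler_norml => /andP[].
Qed.

Lemma bounded_norm_sup : `|sup (range f)| <= B.
Proof.
rewrite ler_norml; apply/andP; split.
  apply: le_trans (bounded_le_sup t0).
  by have := fB t0; rewrite ler_norml => /andP[].
by apply: ge_sup => [|_ [u _ <-]]; [exists (f t0), t0 | exact: le_trans (ler_norm _) (fB u)].
Qed.

Lemma bounded_norm_inf : `|inf (range f)| <= B.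
Proof.
rewrite ler_norml; apply/andP; split.
  apply: lb_le_inf => [|_ [u _ <-]]; first by exists (f t0), t0.
  by have := fB u; rewrite ler_norml => /andP[].
by apply: le_trans (bounded_ge_inf t0) _; exact: le_trans (ler_norm _) (fB t0).
Qed.

End BoundedSup.

Section Semantics.
Context {R : realType} {L : signature R}.

Fixpoint fbound (X : Type) (phi : formula L X) : R :=
  match phi with
  | Pred P _ => `|psym_lo P| + `|psym_hi P|
  | Dist _ _ => `|dist_lo L| + `|dist_hi L|
  | One => 1
  | Add p1 p2 => fbound p1 + fbound p2
  | Scale c p1 => `|c| * fbound p1
  | Sup p1 => fbound p1
  | Inf p1 => fbound p1
  end.

Lemma norm_le_itv (x lo hi : R) : lo <= x <= hi -> `|x| <= `|lo| + `|hi|.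
Proof.
move=> /andP[lox xhi]; have := ler_norm hi; have := ler_norm (- lo).
rewrite normrN => h1 h2; have := normr_ge0 lo; have := normr_ge0 hi.
by move=> h3 h4; rewrite ler_norml; apply/andP; split; lra.
Qed.

Lemma eval_bound (M : structure L) (X : Type) (a : X -> M) (phi : formula L X) :
  `|eval a phi| <= fbound phi.
Proof.
have [m0 _] := carrier_nonempty M.
elim: phi a => {X} /=.
- by move=> X P ts a; apply: norm_le_itv; exact: pred_bounds.
- by move=> X t u a; apply: norm_le_itv; exact: dist_bounds.
- by move=> X a; rewrite normr1.
- by move=> X p1 IH1 p2 IH2 a; apply: le_trans (ler_normD _ _) _; exact: lerD.
- by move=> X c p1 IH a; rewrite normrM ler_wpM2l.
- by move=> X p1 IH a; apply: bounded_norm_sup => // b; exact: IH.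
- by move=> X p1 IH a; apply: bounded_norm_inf => // b; exact: IH.
Qed.

Section Quantifiers.
Context (M : structure L) (X : Type) (a : X -> M) (phi : formula L (option X)).

Lemma eval_Sup_ge (b : M) : eval (oapp a b) phi <= eval a (Sup phi).
Proof.
by apply: (@bounded_le_sup _ _ (fun b => eval (oapp a b) phi)) => c; exact: eval_bound.
Qed.

Lemma eval_Sup_le (c : R) :
  (forall b, eval (oapp a b) phi <= c) -> eval a (Sup phi) <= c.
Proof.
have [m0 _] := carrier_nonempty M.
move=> H; apply: ge_sup => [|_ [b _ <-]]; last exact: H.
by exists (eval (oapp a m0) phi), m0.
Qed.

Lemma eval_Inf_le (b : M) : eval a (Inf phi) <= eval (oapp a b) phi.
Proof.
by apply: (@bounded_ge_inf _ _ (fun b => eval (oapp a b) phi)) => c; exact: eval_bound.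
Qed.

Lemma eval_Inf_ge (c : R) :
  (forall b, c <= eval (oapp a b) phi) -> c <= eval a (Inf phi).
Proof.
have [m0 _] := carrier_nonempty M.
move=> H; apply: lb_le_inf => [|_ [b _ <-]]; last exact: H.
by exists (eval (oapp a m0) phi), m0.
Qed.

Lemma eval_Sup_approx (e : R) : 0 < e ->
  exists b, eval a (Sup phi) - e <= eval (oapp a b) phi.
Proof.
move=> e0; apply/not_existsP => H.
suff : eval a (Sup phi) <= eval a (Sup phi) - e by lra.
by apply: eval_Sup_le => b; rewrite leNgt; apply/negP => /ltW; exact: H.
Qed.

End Quantifiers.

(** Reduces infima to suprema, so that witnesses for suprema suffice. *)
Lemma eval_InfE (M : structure L) (X : Type) (a : X -> M)
    (phi : formula L (option X)) :
  eval a (Inf phi) = - eval a (Sup (Scale (-1) phi)).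
Proof.
apply/eqP; rewrite eq_le; apply/andP; split.
  rewrite lerNr; apply: eval_Sup_le => b /=; rewrite mulN1r lerN2.
  exact: eval_Inf_le.
apply: eval_Inf_ge => b; rewrite lerNl.
by have /= := eval_Sup_ge a (Scale (-1) phi) b; rewrite mulN1r.
Qed.

Lemma modulus_gt0 (delta : modulus R) (e : R) : 0 < e -> 0 < delta e.
Proof.
move=> e0; rewrite lt_neqAle modulus_ge0 ?ltW// andbT; apply/negP => /eqP h.
by have /(modulus_eq0 delta (ltW e0)) h0 := esym h; rewrite h0 ltxx in e0.
Qed.

Lemma respects_close (delta : modulus R) (n : nat) (e : R) : 0 < e ->
  exists2 r, 0 < r & forall (M N : metricType R) (f : ('I_n -> M) -> N) a b,
    respects delta f -> (forall i, mdist (a i) (b i) <= r) ->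
    mdist (f a) (f b) <= e.
Proof.
move=> e0; have d0 := modulus_gt0 delta e0.
(* Dividing by [n.+1] gives the strict inequality that [respects] asks for, and covers [n = 0]. *)
exists (delta e / n.+1%:R); first by rewrite divr_gt0.
move=> M N f a b fd ab; apply: fd => //.
apply: (@le_lt_trans _ _ (\sum_(i < n) (delta e / n.+1%:R))).
  by apply: ler_sum => i _; exact: ab.
rewrite sumr_const card_ord -[ltLHS]mulr_natr mulrAC ltr_pdivrMr//.
by rewrite ltr_pM2l// ltr_nat.
Qed.

Lemma term_unif_cont (X : Type) (t : term L X) (e : R) : 0 < e ->
  exists2 r, 0 < r & forall (M : structure L) (a b : X -> M),
    (forall x, mdist (a x) (b x) <= r) ->
    mdist (term_eval a t) (term_eval b t) <= e.
Proof.
elim: t e => [x|f ts IH] e e0.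
  by exists e => // M a b; apply.
have [r r0 Hr] := respects_close (fsym_modulus f) (fsym_arity f) e0.
have Hi i : {d | 0 < d & forall (M : structure L) (a b : X -> M),
    (forall x, mdist (a x) (b x) <= d) ->
    mdist (term_eval a (ts i)) (term_eval b (ts i)) <= r}.
  exact/cid2/(IH i).
have [m m0 mle] := lowers_pos (fun i => s2valP (Hi i)).
exists m => // M a b ab /=; apply: Hr => [|i]; first exact: fun_respects.
apply: (s2valP' (Hi i)) => x; exact: le_trans (ab x) (mle i).
Qed.

(** The radius is the same for all structures, so that one choice can serve two models. Quantifiers
    leave it unchanged, because both sides receive the same value of the bound variable. *)
Lemma eval_unif_cont (X : Type) (phi : formula L X) (e : R) : 0 < e ->
  exists2 r, 0 < r & forall (M : structure L) (a b : X -> M),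
    (forall x, mdist (a x) (b x) <= r) -> `|eval a phi - eval b phi| <= e.
Proof.
elim: phi e => {X}.
- move=> X P ts e e0.
  have [r r0 Hr] := respects_close (psym_modulus P) (psym_arity P) e0.
  have Hi i : {d | 0 < d & forall (M : structure L) (a b : X -> M),
      (forall x, mdist (a x) (b x) <= d) ->
      mdist (term_eval a (ts i)) (term_eval b (ts i)) <= r}.
    exact/cid2/(term_unif_cont (ts i)).
  have [m m0 mle] := lowers_pos (fun i => s2valP (Hi i)).
  exists m => // M a b ab /=; rewrite -mdist_realE.
  apply: Hr => [|i]; first exact: pred_respects.
  apply: (s2valP' (Hi i)) => x; exact: le_trans (ab x) (mle i).
- move=> X t u e e0; have e20 : 0 < e / 2 by rewrite divr_gt0.
  have [r r0 Hr] := term_unif_cont t e20.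
  have [s s0 Hs] := term_unif_cont u e20.
  exists (Num.min r s); first by rewrite lt_min r0.
  move=> M a b ab /=.
  have {}Hr := Hr M a b (fun x => le_trans (ab x) (minl_le r s)).
  have {}Hs := Hs M a b (fun x => le_trans (ab x) (minr_le r s)).
  have h1 := mdist_tri (term_eval a t) (term_eval b t) (term_eval a u).
  have h2 := mdist_tri (term_eval b t) (term_eval b u) (term_eval a u).
  have h3 := mdist_tri (term_eval b t) (term_eval a t) (term_eval b u).
  have h4 := mdist_tri (term_eval a t) (term_eval a u) (term_eval b u).
  have h5 := mdist_sym (term_eval a t) (term_eval b t).
  have h6 := mdist_sym (term_eval a u) (term_eval b u).
  by rewrite ler_norml; apply/andP; split; lra.
- by move=> X e e0; exists 1 => // M a b _ /=; rewrite subrr normr0 ltW.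
- move=> X p1 IH1 p2 IH2 e e0; have e20 : 0 < e / 2 by rewrite divr_gt0.
  have [r r0 Hr] := IH1 _ e20; have [s s0 Hs] := IH2 _ e20.
  exists (Num.min r s); first by rewrite lt_min r0.
  move=> M a b ab /=.
  have {}Hr := Hr M a b (fun x => le_trans (ab x) (minl_le r s)).
  have {}Hs := Hs M a b (fun x => le_trans (ab x) (minr_le r s)).
  by move: Hr Hs; rewrite !ler_norml => /andP[? ?] /andP[? ?]; apply/andP; split; lra.
- move=> X c p1 IH e e0.
  have c0 : 0 < `|c| + 1 by rewrite ltr_wpDl.
  have [r r0 Hr] := IH (e / (`|c| + 1)) (divr_gt0 e0 c0).
  exists r => // M a b /Hr H /=; rewrite -mulrBr normrM.
  apply: le_trans (ler_wpM2l (normr_ge0 c) H) _.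
  by rewrite mulrCA ger_pMr// ler_pdivrMr// mul1r lerDl.
- move=> X p1 IH e e0; have [r r0 Hr] := IH _ e0.
  exists r => // M.
  suff H (a b : X -> M) : (forall x, mdist (a x) (b x) <= r) ->
      eval a (Sup p1) <= eval b (Sup p1) + e.
    move=> a b ab; rewrite ler_norml; apply/andP; split.
      by rewrite lerBrDr addrC lerBlDr; apply: H => x; rewrite mdist_sym.
    by rewrite lerBlDl; exact: H.
  move=> ab; apply: eval_Sup_le => c.
  have : `|eval (oapp a c) p1 - eval (oapp b c) p1| <= e.
    by apply: Hr => -[x|] //=; rewrite mdistxx ltW.
  have := eval_Sup_ge b p1 c.
  by rewrite ler_norml => ? /andP[? ?]; lra.
- move=> X p1 IH e e0; have [r r0 Hr] := IH _ e0.
  exists r => // M.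
  suff H (a b : X -> M) : (forall x, mdist (a x) (b x) <= r) ->
      eval b (Inf p1) - e <= eval a (Inf p1).
    move=> a b ab; rewrite ler_norml; apply/andP; split.
      by rewrite lerBrDr addrC; exact: H.
    rewrite lerBlDr addrC -lerBlDr; apply: H => x; by rewrite mdist_sym.
  move=> ab; apply: eval_Inf_ge => c.
  have : `|eval (oapp a c) p1 - eval (oapp b c) p1| <= e.
    by apply: Hr => -[x|] //=; rewrite mdistxx ltW.
  have := eval_Inf_le b p1 c.
  by rewrite ler_norml => ? /andP[? ?]; lra.
Qed.

End Semantics.

(** * Continuity moduli *)

Section Modulus.
Context {R : realType} (delta : modulus R).

Lemma modulus0 : delta 0 = 0.
Proof. by apply/(modulus_eq0 delta (lexx 0)). Qed.

Lemma modulus_conv (x y t : R) : 0 <= x -> 0 <= y -> 0 <= t <= 1 ->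
  delta (t * x + (1 - t) * y) <= t * delta x + (1 - t) * delta y.
Proof.
move=> x0 y0 /andP[t0 t1].
have xD : (x : R^o) \in (`[0, +oo[%classic : set R^o).
  by rewrite inE /= in_itv /= x0.
have yD : (y : R^o) \in (`[0, +oo[%classic : set R^o).
  by rewrite inE /= in_itv /= y0.
exact: (modulus_convex delta (Itv01 t0 t1) xD yD).
Qed.

Lemma modulus_scale (x t : R) : 0 <= x -> 0 <= t <= 1 ->
  delta (t * x) <= t * delta x.
Proof.
by move=> x0 t01; have := modulus_conv x0 (lexx 0) t01; rewrite modulus0 !mulr0 !addr0.
Qed.

(** The slope [m] is the left derivative at [e], taken as the supremum of the slopes of chords
    ending at [e]; convexity bounds it by every chord slope to the right. The chord from 0 has slope
    [delta e / e], whence [0 <= m]. *)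
Lemma modulus_subgradient (e : R) : 0 < e ->
  exists2 m, 0 <= m & forall z : R, 0 <= z -> delta e + m * (z - e) <= delta z.
Proof.
move=> e0.
pose S := [set m | exists2 z, 0 <= z < e & m = (delta e - delta z) / (e - z)].
have S0 : S (delta e / e).
  by exists 0; [rewrite lexx | rewrite modulus0 !subr0].
have Sub w : e < w -> ubound S ((delta w - delta e) / (w - e)).
  move=> ew _ [z /andP[z0 ze] ->].
  have ez0 : 0 < e - z by rewrite subr_gt0.
  have we0 : 0 < w - e by rewrite subr_gt0.
  rewrite ler_pdivrMr// mulrAC ler_pdivlMr//.
  have wz0 : 0 < w - z by lra.
  have := @modulus_conv z w ((w - e) / (w - z)) z0 ltac:(lra).
  have -> : (w - e) / (w - z) * z + (1 - (w - e) / (w - z)) * w = e.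
    by field; lra.
  have -> : 0 <= (w - e) / (w - z) <= 1.
    apply/andP; split; first by apply: divr_ge0; exact: ltW.
    by rewrite ler_pdivrMr// mul1r; lra.
  move=> /(_ isT) h.
  have {h} : (w - z) * delta e <= (w - e) * delta z + (e - z) * delta w.
    have := ler_wpM2l (ltW wz0) h.
    suff -> : (w - z) * ((w - e) / (w - z) * delta z +
      (1 - (w - e) / (w - z)) * delta w) =
      (w - e) * delta z + (e - z) * delta w by [].
    by field; lra.
  by nra.
have Sup : has_ubound S by exists ((delta (e + 1) - delta e) / (e + 1 - e)); apply: Sub; lra.
exists (sup S).
  apply: le_trans (ub_le_sup Sup S0).
  by apply: divr_ge0; [apply: modulus_ge0|]; exact: ltW.
move=> z z0; have [ez|ze|->] := ltrgtP e z; last by rewrite subrr mulr0 addr0.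
  have ze0 : 0 < z - e by rewrite subr_gt0.
  have : sup S <= (delta z - delta e) / (z - e).
    by apply: ge_sup; [exists (delta e / e) | exact: Sub].
  by rewrite ler_pdivlMr//; lra.
have ez0 : 0 < e - z by rewrite subr_gt0.
have : (delta e - delta z) / (e - z) <= sup S.
  by apply: ub_le_sup => //; exists z => //; rewrite z0.
by rewrite ler_pdivrMr//; lra.
Qed.

(** A convex function vanishing at 0 lies below its chord from the origin to [x + y], and the bounds
    at [x] and at [y] add up. This is what makes radii of approximation additive in
    [extend_respects]. *)
Lemma modulus_superadd (x y : R) : 0 <= x -> 0 <= y ->
  delta x + delta y <= delta (x + y).
Proof.
move=> x0 y0; have [xy0|xy0] := eqVneq (x + y) 0.
  have [-> ->] : x = 0 /\ y = 0 by split; lra.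
  by rewrite addr0 modulus0 addr0.
have {}xy0 : 0 < x + y by rewrite lt_neqAle eq_sym xy0 addr_ge0.
have h z : 0 <= z -> z <= x + y -> delta z <= z / (x + y) * delta (x + y).
  move=> z0 zxy; rewrite -[X in delta X](divfK (lt0r_neq0 xy0)).
  apply: modulus_scale; first exact: ltW.
  apply/andP; split; first by apply: divr_ge0 => //; exact: ltW.
  by rewrite ler_pdivrMr// mul1r.
apply: le_trans (lerD (h x x0 _) (h y y0 _)) _; rewrite ?lerDl ?lerDr//.
by rewrite -mulrDl -mulrDl divff ?mul1r// gt_eqF.
Qed.

End Modulus.

(** * Completions *)

Lemma real_eps (R : realType) (x y : R) :
  (forall e : R, 0 < e -> x <= y + e) -> x <= y.
Proof. by move=> h; apply/ler_addgt0Pr. Qed.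

Lemma lt_halves_gap (R : realType) (u v w c : R) :
  u < (c - w) / 2 -> v < (c - w) / 2 -> u + w + v < c.
Proof. lra. Qed.

(* A form of completeness adapted to building points from approximations: any
   coherent family of closed balls of arbitrarily small radii has a common
   point. *)
Definition has_limits (R : realType) (N : metricType R) : Prop :=
  forall S : N -> R -> Prop,
    (forall e : R, 0 < e -> exists x r, S x r /\ r <= e) ->
    (forall x r y s, S x r -> S y s -> mdist x y <= r + s) ->
    exists g, forall x r, S x r -> mdist g x <= r.

Section Limits.
Context {R : realType}.

(** Coherence puts every left endpoint below every right endpoint, so the infimum of the right
    endpoints lies in all the intervals. *)
Lemma real_limits : has_limits (R^o : metricType R).
Proof.
move=> S Ssmall Scoh.
pose E := [set v : R | exists x r, S x r /\ v = (x : R) + r].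
have E0 : E !=set0.
  by have [x [r [Sxr _]]] := Ssmall 1 ltr01; exists ((x : R) + r), x, r.
have lbE x r : S x r -> lbound E ((x : R) - r).
  move=> Sxr _ [y [s [Sys ->]]]; have := Scoh _ _ _ _ Sxr Sys.
  by rewrite mdist_realE ler_norml => /andP[_]; lra.
exists (inf E) => x r Sxr; rewrite mdist_realE ler_norml; apply/andP; split.
  by have := lb_le_inf E0 (lbE _ _ Sxr); lra.
have : inf E <= (x : R) + r.
  by apply: ge_inf; [exists ((x : R) - r); exact: lbE | exists x, r].
lra.
Qed.

Lemma limits_complete (N : metricType R) : has_limits N ->
  forall F : set_system N, ProperFilter F -> cauchy F ->
    exists a : N, F --> a.
Proof.
move=> Nlim F FF /cauchyP Fc.
have [||g Hg] := Nlim (fun x r => 0 < r /\ F (ball x r)).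
- by move=> e e0; have [x Fx] := Fc e e0; exists x, e.
- move=> x r y s [r0 Fx] [s0 Fy].
  have [z [xz yz]] := filter_ex (filterI Fx Fy).
  move: xz yz; rewrite !ballEmdist /= => xz yz.
  apply: le_trans (mdist_tri x z y) _; rewrite (mdist_sym z y).
  by apply: lerD; exact: ltW.
exists g => U /nbhs_ballP[e /= e0 eU].
have e20 : 0 < e / 2 by rewrite divr_gt0.
have [x Fx] := Fc _ e20.
apply: (filterS _ Fx) => y; rewrite ballEmdist /= => xy; apply: eU.
rewrite ballEmdist /=.
apply: le_lt_trans (mdist_tri g x y) _.
have : mdist g x <= e / 2 by apply: Hg; split.
lra.
Qed.

End Limits.

Section Extension.
Context {R : realType} {A : Type} (d : A -> A -> R) {M : metricType R}
  (h : A -> M).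
Hypothesis h_dist : forall a b, mdist (h a) (h b) = d a b.
Hypothesis h_dense : forall m (e : R), 0 < e -> exists a, mdist m (h a) <= e.
Context {k : nat}.

Lemma tuple_approx (x : 'I_k -> M) (c : R) : 0 < c ->
  exists a : 'I_k -> A, \sum_(i < k) mdist (x i) (h (a i)) < c.
Proof.
move=> c0; have ck : 0 < c / k.+1%:R by rewrite divr_gt0.
have H i : {a | mdist (x i) (h a) <= c / k.+1%:R} by exact/cid/h_dense.
exists (fun i => sval (H i)).
apply: (@le_lt_trans _ _ (\sum_(i < k) (c / k.+1%:R))).
  by apply: ler_sum => i _; exact: (svalP (H i)).
rewrite sumr_const card_ord -[ltLHS]mulr_natr mulrAC ltr_pdivrMr//.
by rewrite ltr_pM2l// ltr_nat.
Qed.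

Lemma sum_mdist_approx (x y : 'I_k -> M) (a b : 'I_k -> A) :
  \sum_(i < k) d (a i) (b i) <=
  \sum_(i < k) mdist (x i) (h (a i)) + \sum_(i < k) mdist (x i) (y i) +
  \sum_(i < k) mdist (y i) (h (b i)).
Proof.
rewrite -!big_split /=; apply: ler_sum => i _; rewrite -h_dist.
apply: le_trans (mdist_tri _ (x i) _) _.
rewrite (mdist_sym (h _)) -addrA lerD2l.
exact: mdist_tri.
Qed.

(** The value at [x] is the common point of the balls of radius [e] around [f a], for [a] closer to
    [x] than [delta e]; superadditivity of [delta] makes these balls coherent. *)
Lemma extend_respects (N : metricType R) (delta : modulus R)
    (f : ('I_k -> A) -> N) :
  has_limits N ->
  (forall (e : R) a b, 0 < e -> \sum_(i < k) d (a i) (b i) < delta e ->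
    mdist (f a) (f b) <= e) ->
  exists F : ('I_k -> M) -> N, [/\ respects delta F,
    forall a, F (h \o a) = f a &
    forall x a (e : R), 0 < e -> \sum_(i < k) mdist (x i) (h (a i)) < delta e ->
      mdist (F x) (f a) <= e].
Proof.
move=> Nlim fd.
have H x : exists g, forall a (e : R), 0 < e ->
    \sum_(i < k) mdist (x i) (h (a i)) < delta e -> mdist g (f a) <= e.
  have [||g Hg] := Nlim (fun y r => exists a, [/\ y = f a, 0 < r &
      \sum_(i < k) mdist (x i) (h (a i)) < delta r]).
  - move=> e e0; have [a Ha] := tuple_approx x (modulus_gt0 delta e0).
    by exists (f a), e; split => //; exists a.
  - move=> y r z s [a [-> r0 ar]] [b [-> s0 bs]].
    apply: fd; first exact: addr_gt0.
    apply: le_lt_trans (sum_mdist_approx x x a b) _.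
    rewrite [X in _ + X + _]big1; last by move=> i _; rewrite mdistxx.
    rewrite addr0; apply: lt_le_trans (modulus_superadd _ (ltW r0) (ltW s0)).
    exact: ltrD.
  - by exists g => a e e0 ae; apply: Hg; exists a.
pose F x := sval (cid (H x)).
have FP x a (e : R) : 0 < e -> \sum_(i < k) mdist (x i) (h (a i)) < delta e ->
    mdist (F x) (f a) <= e by exact: (svalP (cid (H x))).
exists F; split=> //.
  move=> e x y e0 xye; apply: real_eps => r r0.
  have r20 : 0 < r / 2 by rewrite divr_gt0.
  (* The strict inequality leaves a gap, and each of the two approximating tuples may use up half of
     it. *)
  pose g := delta e - \sum_(i < k) mdist (x i) (y i).
  have g0 : 0 < g / 2 by rewrite divr_gt0// subr_gt0.
  have c0 : 0 < Num.min (g / 2) (delta (r / 2)) by rewrite lt_min g0 modulus_gt0.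
  have [a] := tuple_approx x c0; rewrite lt_min => /andP[ag ar].
  have [b] := tuple_approx y c0; rewrite lt_min => /andP[bg br].
  have h1 := FP x a _ r20 ar; have h2 := FP y b _ r20 br.
  have h3 : mdist (f a) (f b) <= e.
    apply: fd => //; apply: le_lt_trans (sum_mdist_approx x y a b) _.
    exact: lt_halves_gap ag bg.
  have h4 := mdist_tri (F x) (f a) (F y).
  have h5 := mdist_tri (f a) (f b) (F y).
  by rewrite (mdist_sym (F y)) in h2; lra.
move=> a; apply: mdist_positivity; apply/eqP; rewrite eq_le mdist_ge0 andbT.
apply: real_eps => r r0; rewrite add0r; apply: FP => //.
by rewrite big1 ?modulus_gt0// => i _; rewrite mdistxx.
Qed.

End Extension.

Lemma mdist_lipschitz (R : realType) (M : metricType R) (x y x' y' : M) :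
  `|mdist x y - mdist x' y'| <= mdist x x' + mdist y y'.
Proof.
have h1 := mdist_tri x x' y; have h2 := mdist_tri x' y' y.
have h3 := mdist_tri x' x y'; have h4 := mdist_tri x y y'.
rewrite (mdist_sym y' y) in h2; rewrite (mdist_sym x' x) in h3.
by rewrite ler_norml; apply/andP; split; lra.
Qed.

Section Completion.
Context {R : realType} {A : Type} (d : A -> A -> R).

(* Kuratowski's completion: a point is given by its distances to [A]. *)
Definition completion : Type :=
  {f : A -> R | forall e : R, 0 < e -> exists a, forall b, `|f b - d a b| <= e}.

HB.instance Definition _ := gen_eqMixin completion.
HB.instance Definition _ := gen_choiceMixin completion.

Definition completion_dist (f g : completion) : R :=
  sup (range (fun b => `|sval f b - sval g b|)).

Context (a0 : A) (B : R).
Hypothesis dxx : forall a, d a a = 0.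
Hypothesis d_sym : forall a b, d a b = d b a.
Hypothesis d_tri : forall b a c, d a c <= d a b + d b c.
Hypothesis dB : forall a b, `|d a b| <= B.

Lemma completion_bounded (f g : completion) b :
  `|(`|sval f b - sval g b|)| <= 2 * (B + 1).
Proof.
have H (f' : completion) : `|sval f' b| <= B + 1.
  have [a Ha] := svalP f' 1 ltr01.
  have := ler_normD (sval f' b - d a b) (d a b); rewrite subrK.
  by have := Ha b; have := dB a b; lra.
rewrite normr_id; have := ler_normB (sval f b) (sval g b).
by have := H f; have := H g; lra.
Qed.

Lemma completion_dist_ge (f g : completion) b :
  `|sval f b - sval g b| <= completion_dist f g.
Proof. by apply: (bounded_le_sup (completion_bounded f g)). Qed.

Lemma completion_dist_le (f g : completion) (c : R) :
  (forall b, `|sval f b - sval g b| <= c) -> completion_dist f g <= c.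
Proof.
move=> H; apply: ge_sup => [|_ [b _ <-]]; last exact: H.
by exists `|sval f a0 - sval g a0|, a0.
Qed.

Lemma completion_distxx f : completion_dist f f = 0.
Proof.
apply/eqP; rewrite eq_le; apply/andP; split.
  by apply: completion_dist_le => b; rewrite subrr normr0.
by apply: le_trans (completion_dist_ge f f a0); rewrite subrr normr0.
Qed.

Lemma completion_dist_pos f g : completion_dist f g = 0 -> f = g.
Proof.
case: f g => f fP [g gP] fg; apply: eq_exist; apply/funext => b.
have := completion_dist_ge (exist _ f fP) (exist _ g gP) b.
by rewrite fg normr_le0 subr_eq0 => /eqP.
Qed.

Lemma completion_dist_sym f g : completion_dist f g = completion_dist g f.
Proof.
by apply/eqP; rewrite eq_le; apply/andP; split;
  apply: completion_dist_le => b; rewrite distrC; exact: completion_dist_ge.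
Qed.

Lemma completion_dist_tri g f k :
  completion_dist f k <= completion_dist f g + completion_dist g k.
Proof.
apply: completion_dist_le => b.
rewrite -(subrKA (sval g b)); apply: le_trans (ler_normD _ _) _.
by apply: lerD; exact: completion_dist_ge.
Qed.

(** Points of [A] at distance 0 have the same distance function and are thereby identified. Limits
    are taken coordinatewise in the reals; the radii control them uniformly, so the limit is again
    approximated by distance functions. *)
Lemma completion_exists : exists (M : metricType R) (h : A -> M),
  [/\ has_limits M, forall a b, mdist (h a) (h b) = d a b &
      forall m (e : R), 0 < e -> exists a, mdist m (h a) <= e].
Proof.
pose mx := isMetric.Build R completion completion_distxx completion_dist_pos
  completion_dist_sym completion_dist_tri.
pose M : metricType R := HB.pack completion mx.
have hP a (e : R) : 0 < e -> exists a', forall b, `|d a b - d a' b| <= e.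
  by move=> e0; exists a => b; rewrite subrr normr0 ltW.
pose h a : M := exist _ (d a) (hP a).
exists M, h; split.
- move=> S Ssmall Scoh.
  have H b : exists g : R, forall (x : completion) r, S x r -> `|g - sval x b| <= r.
    have [||g Hg] := @real_limits R (fun v r => exists2 x : completion,
        S x r & v = sval x b).
    + move=> e e0; have [x [r [Sxr re]]] := Ssmall e e0.
      by exists (sval (x : completion) b), r; split => //; exists x.
    + move=> v r w s [x Sxr ->] [y Sys ->]; rewrite mdist_realE.
      exact: le_trans (completion_dist_ge x y b) (Scoh _ _ _ _ Sxr Sys).
    + by exists g => x r Sxr; rewrite -mdist_realE; apply: Hg; exists x.
  pose g b := sval (cid (H b)).
  have gP b (x : completion) r : S x r -> `|g b - sval x b| <= r.
    exact: (svalP (cid (H b))).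
  have gC (e : R) : 0 < e -> exists a, forall b, `|g b - d a b| <= e.
    move=> e0; have e20 : 0 < e / 2 by rewrite divr_gt0.
    have [x [r [Sxr re]]] := Ssmall _ e20.
    have [a Ha] := svalP (x : completion) _ e20.
    exists a => b; rewrite -(subrKA (sval (x : completion) b)).
    apply: le_trans (ler_normD _ _) _.
    by have := Ha b; have := gP b x r Sxr; lra.
  exists (exist _ g gC) => x r Sxr.
  by apply: completion_dist_le => b; exact: gP.
- move=> a b; apply/eqP; rewrite eq_le; apply/andP; split.
    apply: completion_dist_le => c /=.
    have := d_tri b a c; have := d_tri a b c; have := d_sym a b.
    by rewrite ler_norml => *; apply/andP; split; lra.
  have /= := completion_dist_ge (h a) (h b) b; rewrite dxx subr0.
  exact: le_trans (ler_norm _).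
- move=> m e e0; have [a Ha] := svalP (m : completion) e e0.
  by exists a; apply: completion_dist_le => b; exact: Ha.
Qed.

End Completion.

(** The data that a state defines on terms: [pdist] is only a pseudometric, since distinct terms may
    have distance 0, and completeness is left out as well. *)
Record prestructure (R : realType) (L : signature R) := Prestructure {
  pcarrier :> Type;
  ppoint : pcarrier;
  pdist : pcarrier -> pcarrier -> R;
  pdistxx : forall a, pdist a a = 0;
  pdist_sym : forall a b, pdist a b = pdist b a;
  pdist_tri : forall b a c, pdist a c <= pdist a b + pdist b c;
  pdist_bounds : forall a b, dist_lo L <= pdist a b <= dist_hi L;
  pdist_respects : forall (e : R) (a b : 'I_2 -> pcarrier), 0 < e ->
    \sum_(i < 2) pdist (a i) (b i) < dist_modulus L e ->
    `|pdist (a ord0) (a ord_max) - pdist (b ord0) (b ord_max)| <= e;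
  pfun : forall f : Defs.fsym L, ('I_(fsym_arity f) -> pcarrier) -> pcarrier;
  pfun_respects : forall f (e : R) a b, 0 < e ->
    \sum_i pdist (a i) (b i) < fsym_modulus f e ->
    pdist (@pfun f a) (@pfun f b) <= e;
  ppred : forall P : psym L, ('I_(psym_arity P) -> pcarrier) -> R;
  ppred_bounds : forall (P : psym L) a, psym_lo P <= @ppred P a <= psym_hi P;
  ppred_respects : forall P (e : R) a b, 0 < e ->
    \sum_i pdist (a i) (b i) < psym_modulus P e ->
    `|@ppred P a - @ppred P b| <= e
}.

Lemma prestructure_completion (R : realType) (L : signature R)
    (A : prestructure L) :
  exists (M : structure L) (h : A -> M),
    [/\ forall a b, mdist (h a) (h b) = pdist a b,
        forall m (e : R), 0 < e -> exists a, mdist m (h a) <= e,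
        forall (f : Defs.fsym L) a, fun_interp (h \o a) = h (@pfun _ _ _ f a) &
        forall (P : psym L) a, pred_interp (h \o a) = @ppred _ _ _ P a].
Proof.
have [M [h [Mlim hd hdense]]] := @completion_exists R A (@pdist _ _ A)
  (ppoint A) _ (@pdistxx _ _ A) (@pdist_sym _ _ A) (@pdist_tri _ _ A)
  (fun a b => norm_le_itv (pdist_bounds a b)).
have ext := extend_respects hd hdense.
have HF f := cid (ext _ M (fsym_modulus f) (fun a => h (@pfun _ _ A f a)) Mlim
  (fun e a b e0 ab => ltac:(rewrite hd; exact: pfun_respects e0 ab))).
have HP P := cid (ext _ (R^o : metricType R) (psym_modulus P)
  (fun a => @ppred _ _ A P a) real_limits
  (fun e a b e0 ab => ltac:(rewrite mdist_realE; exact: ppred_respects e0 ab))).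
have M0 : [set: M] !=set0 by exists (h (ppoint A)).
have Mc := limits_complete Mlim.
have Ff f : respects (fsym_modulus f) (sval (HF f)).
  by have [] := svalP (HF f).
have Pr P : respects (psym_modulus P) (sval (HP P) : _ -> R^o).
  by have [] := svalP (HP P).
have Pb P x : psym_lo P <= (sval (HP P) x : R) <= psym_hi P.
  have [_ _ Pa] := svalP (HP P).
  suff H (r : R) : 0 < r -> psym_lo P - r <= (sval (HP P) x : R) <= psym_hi P + r.
    apply/andP; split; apply: real_eps => r r0; have /andP[] := H r r0; lra.
  move=> r0; have [a Ha] := tuple_approx hdense x (modulus_gt0 (psym_modulus P) r0).
  have := Pa x a r r0 Ha; rewrite mdist_realE ler_norml => /andP[].
  have /andP[] := ppred_bounds (P := P) a.
  by move=> ? ? ? ?; apply/andP; split; lra.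
have approx (x : 'I_2 -> M) (r : R) : 0 < r -> exists a : 'I_2 -> A,
    \sum_(i < 2) mdist (x i) (h (a i)) < r /\
    `|mdist (x ord0) (x ord_max) - pdist (a ord0) (a ord_max)| <= r.
  move=> r0; have [a Ha] := tuple_approx hdense x r0.
  exists a; split=> //; rewrite -hd; apply: le_trans (mdist_lipschitz _ _ _ _) _.
  move: Ha; rewrite !big_ord_recl big_ord0 addr0 => /ltW.
  by rewrite (_ : lift ord0 ord0 = ord_max)//; exact/val_inj.
have Db (x y : M) : dist_lo L <= mdist x y <= dist_hi L.
  suff H (r : R) : 0 < r -> dist_lo L - r <= mdist x y <= dist_hi L + r.
    apply/andP; split; apply: real_eps => r r0; have /andP[] := H r r0; lra.
  move=> r0; pose xy (i : 'I_2) := if i == ord0 then x else y.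
  have [a [_]] := approx xy r r0.
  rewrite ler_norml /xy /= => /andP[].
  have /andP[] := pdist_bounds (a ord0) (a ord_max).
  by move=> ? ? ? ?; apply/andP; split; lra.
have Dr : respects (dist_modulus L)
    ((fun a => mdist (a ord0) (a ord_max)) : ('I_2 -> M) -> R^o).
  move=> e x y e0 xye; apply: real_eps => r r0; rewrite mdist_realE.
  pose g := dist_modulus L e - \sum_(i < 2) mdist (x i) (y i).
  have g0 : 0 < g / 2 by rewrite divr_gt0// subr_gt0.
  have c0 : 0 < Num.min (g / 2) (r / 2) by rewrite lt_min g0 divr_gt0.
  have [a [a1 a2]] := approx x _ c0; have [b [b1 b2]] := approx y _ c0.
  have cg := minl_le (g / 2) (r / 2); have cr := minr_le (g / 2) (r / 2).
  have : `|pdist (a ord0) (a ord_max) - pdist (b ord0) (b ord_max)| <= e.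
    apply: pdist_respects => //.
    apply: le_lt_trans (sum_mdist_approx hd x y a b) _.
    exact: lt_halves_gap (lt_le_trans a1 cg) (lt_le_trans b1 cg).
  move: a2 b2; rewrite !ler_norml => /andP[? ?] /andP[? ?] /andP[? ?].
  by apply/andP; split; lra.
exists (Structure M0 Mc Ff Pb Pr Db Dr), h; split=> //.
- by move=> f a /=; have [_ + _] := svalP (HF f); exact.
- by move=> P a /=; have [_ + _] := svalP (HP P); exact.
Qed.

(** * Henkin states and their models *)

(* Variables with Henkin witnesses: [HWit psi r] is meant to realize the
   supremum of [psi] over its bound variable at the parameters [r].  Taking
   [psi] over a finite context ['I_n], with its parameters listed apart, is what
   makes the definition strictly positive. *)
Inductive hv (R : realType) (L : signature R) (X : Type) : Type :=
| HBase of X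
| HWit (n : nat) (psi : formula L (option 'I_n)) of 'I_n -> hv L X.

Section Functionals.
Context {R : realType} {L : signature R} (T : theory L).

Definition tle (Y : Type) (phi psi : formula L Y) : Prop :=
  forall M : structure L, models M T ->
    forall a : Y -> M, eval a phi <= eval a psi.

(* Affine types as abstract functionals: all the conditions are affine and
   closed, hence stable under mixtures and pointwise limits. *)
Definition state (Y : Type) (q : formula L Y -> R) : Prop :=
  [/\ q (One L Y) = 1,
      forall p1 p2, q (Add p1 p2) = q p1 + q p2,
      forall c p, q (Scale c p) = c * q p &
      forall p1 p2, tle p1 p2 -> q p1 <= q p2].

(** Only one inequality is required: the opposite one holds in every state, since no instance of
    [psi] exceeds its supremum in a model. *)
Definition henkin (X : Type) (q : formula L (hv L X) -> R) : Prop :=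
  state q /\ forall (n : nat) (psi : formula L (option 'I_n)) r,
    q (rename r (Sup psi)) <= q (rename (oapp r (HWit psi r)) psi).

Definition fsum (Y : Type) (l : seq (formula L Y)) : formula L Y :=
  foldr (@Add R L Y) (Scale 0 (One L Y)) l.

Lemma state_eval (M : structure L) (Y : Type) (a : Y -> M) :
  models M T -> state (fun phi => eval a phi).
Proof. by move=> MT; split=> // p1 p2; apply. Qed.

Section State.
Context {Y : Type} {q : formula L Y -> R} (qs : state q).

Lemma state_One : q (One L Y) = 1. Proof. by case: qs. Qed.

Lemma state_Add p1 p2 : q (Add p1 p2) = q p1 + q p2.
Proof. by case: qs. Qed.

Lemma state_Scale c p : q (Scale c p) = c * q p.
Proof. by case: qs. Qed.

Lemma state_le p1 p2 : tle p1 p2 -> q p1 <= q p2.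
Proof. by case: qs => _ _ _; apply. Qed.

Lemma state_eq p1 p2 :
  (forall (M : structure L) (a : Y -> M), eval a p1 = eval a p2) ->
  q p1 = q p2.
Proof.
by move=> H; apply/eqP; rewrite eq_le; apply/andP; split;
  apply: state_le => M _ a; rewrite H.
Qed.

Lemma state_fsum l : q (fsum l) = \sum_(p <- l) q p.
Proof.
elim: l => [|p l IH]; first by rewrite big_nil /= state_Scale mul0r.
by rewrite big_cons /= state_Add IH.
Qed.

Lemma state_itv lo hi p :
  (forall (M : structure L) (a : Y -> M), models M T -> lo <= eval a p <= hi) ->
  lo <= q p <= hi.
Proof.
move=> H; apply/andP; split.
  rewrite -[leLHS]mulr1 -state_One -state_Scale; apply: state_le => M MT a /=.
  by rewrite mulr1; case/andP: (H M a MT).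
rewrite -[leRHS]mulr1 -state_One -state_Scale; apply: state_le => M MT a /=.
by rewrite mulr1; case/andP: (H M a MT).
Qed.

(* A convex modulus is a supremum of affine functions, so that respecting it
   amounts to a family of affine conditions, and these pass to states. *)
Lemma state_modulus (delta : modulus R) (S E : formula L Y) (e : R) :
  (forall (M : structure L) (a : Y -> M), 0 <= eval a S) ->
  (forall (M : structure L) (a : Y -> M) (e' : R), 0 < e' ->
    eval a S < delta e' -> eval a E <= e') ->
  0 < e -> q S < delta e -> q E <= e.
Proof.
move=> S0 SE e0 qS.
have [m m0 Hm] := modulus_subgradient delta e0.
have : q (Add (Scale (delta e - m * e) (One L Y)) (Scale m E)) <= q S.
  apply: state_le => M _ a /=; rewrite mulr1.
  have de : delta e - m * e <= 0.
    by have := Hm 0 (lexx 0); rewrite modulus0; lra.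
  have [E0|E0] := leP (eval a E) 0.
    by have := S0 M a; have := mulr_ge0_le0 m0 E0; lra.
  apply: real_eps => c c0.
  (* A point strictly below [eval a E], so that the hypothesis yields [delta z <= eval a S]; it is
     close enough to cost at most [c] after multiplication by [m], and the term [eval a E / 2] keeps
     it positive. *)
  pose z := Num.max (eval a E / 2) (eval a E - c / (m + 1)).
  have m1 : 0 < m + 1 by rewrite ltr_wpDl.
  have z0 : 0 < z by rewrite lt_max divr_gt0.
  have zE : z < eval a E.
    rewrite gt_max; apply/andP; split; first lra.
    by rewrite gtrBl divr_gt0.
  have : delta z <= eval a S.
    rewrite leNgt; apply/negP => /(SE M a z z0); rewrite leNgt.
    by rewrite zE.
  have := Hm z (ltW z0).
  have : eval a E - c / (m + 1) <= z by rewrite le_max lexx orbT.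
  have : m * (c / (m + 1)) <= c.
    by rewrite mulrCA ger_pMr// ler_pdivrMr// mul1r lerDl.
  move=> h1 h2 h3 h4.
  have := ler_wpM2l m0 h2; lra.
rewrite state_Add !state_Scale state_One => H.
rewrite leNgt; apply/negP => qE.
have : 0 <= m * (q E - e) by rewrite mulr_ge0// subr_ge0 ltW.
lra.
Qed.

(** An absolute value is not an affine condition, so the two signed differences are bounded
    separately. *)
Lemma state_modulus_norm (delta : modulus R) k (s t : 'I_k -> term L Y)
    (p1 p2 : formula L Y) (e : R) :
  (forall (M : structure L) (a : Y -> M) (e' : R), 0 < e' ->
    \sum_(i < k) mdist (term_eval a (s i)) (term_eval a (t i)) < delta e' ->
    `|eval a p1 - eval a p2| <= e') ->
  0 < e -> \sum_(i < k) q (Dist (s i) (t i)) < delta e -> `|q p1 - q p2| <= e.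
Proof.
move=> H e0.
pose S := fsum [seq Dist (s i) (t i) | i <- index_enum 'I_k].
have SE (M : structure L) (a : Y -> M) :
    eval a S = \sum_(i < k) mdist (term_eval a (s i)) (term_eval a (t i)).
  rewrite /S; elim: (index_enum _) => [|i l IH] /=; first by rewrite big_nil mul0r.
  by rewrite big_cons IH.
have -> : \sum_(i < k) q (Dist (s i) (t i)) = q S.
  by rewrite state_fsum big_map.
have S0 (M : structure L) (a : Y -> M) : 0 <= eval a S.
  by rewrite SE sumr_ge0// => i _; exact: mdist_ge0.
move=> qS.
have h p p' : (forall (M : structure L) (a : Y -> M) (e' : R), 0 < e' ->
    eval a S < delta e' -> `|eval a p - eval a p'| <= e') -> q p - q p' <= e.
  move=> Hp; have := @state_modulus delta S (Add p (Scale (-1) p')) e S0.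
  rewrite state_Add state_Scale mulN1r; apply=> // M a e' e'0 /(Hp M a e' e'0) /=.
  by rewrite mulN1r; exact: le_trans (ler_norm _).
rewrite ler_norml; apply/andP; split.
  rewrite lerNl opprB; apply: h => M a e' e'0; rewrite SE distrC.
  exact: H.
by apply: h => M a e' e'0; rewrite SE; exact: H.
Qed.

Lemma state_dist_modulus (delta : modulus R) k (s t : 'I_k -> term L Y)
    (u v : term L Y) (e : R) :
  (forall (M : structure L) (a : Y -> M) (e' : R), 0 < e' ->
    \sum_(i < k) mdist (term_eval a (s i)) (term_eval a (t i)) < delta e' ->
    mdist (term_eval a u) (term_eval a v) <= e') ->
  0 < e -> \sum_(i < k) q (Dist (s i) (t i)) < delta e -> q (Dist u v) <= e.
Proof.
move=> H e0 qS.
have := @state_modulus_norm delta k s t (Dist u v) (Scale 0 (One L Y)) e.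
rewrite state_Scale mul0r subr0 => h.
apply: le_trans (ler_norm _) (h _ e0 qS) => M a e' e'0 /(H M a e' e'0) /=.
by rewrite mul0r subr0 ger0_norm ?mdist_ge0.
Qed.

End State.

Section TermModel.
Context {X : Type} {q : formula L (hv L X) -> R} (qh : henkin q).

Let qs : state q := qh.1.

(** [X] may be empty; a witness without parameters still provides a term. *)
Let hv_point : hv L X :=
  HWit (One L (option 'I_0)) (fun i => match notF (ltn_ord i) with end).

Lemma term_prestructure : exists A : prestructure L,
  exists2 h : term L (hv L X) -> A, (forall a : A, exists t, a = h t) &
  [/\ forall s t, pdist (h s) (h t) = q (Dist s t),
      forall (f : Defs.fsym L) ts, pfun (h \o ts) = h (@App _ _ _ f ts) &
      forall (P : psym L) ts, ppred (h \o ts) = q (@Pred _ _ _ P ts)].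
Proof.
pose A := term L (hv L X).
have h1 (s : A) : q (Dist s s) = 0.
  rewrite -(mul0r (q (One _ _))) -(state_Scale qs); apply: (state_eq qs) => M a /=.
  by rewrite mdistxx mul0r.
have h2 (s t : A) : q (Dist s t) = q (Dist t s).
  by apply: (state_eq qs) => M a /=; rewrite mdist_sym.
have h3 (t s u : A) : q (Dist s u) <= q (Dist s t) + q (Dist t u).
  by rewrite -(state_Add qs); apply: (state_le qs) => M _ a /=; exact: mdist_tri.
have h4 (s t : A) : dist_lo L <= q (Dist s t) <= dist_hi L.
  by apply: (state_itv qs) => M a _; exact: dist_bounds.
have h5 (e : R) (a b : 'I_2 -> A) : 0 < e ->
    \sum_(i < 2) q (Dist (a i) (b i)) < dist_modulus L e ->
    `|q (Dist (a ord0) (a ord_max)) - q (Dist (b ord0) (b ord_max))| <= e.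
  apply: (state_modulus_norm qs) => M c e' e'0 H /=; rewrite -mdist_realE.
  exact: (dist_respects e'0 (a := fun i => term_eval c (a i))
    (b := fun i => term_eval c (b i)) H).
have h6 (f : Defs.fsym L) (e : R) (a b : 'I_(fsym_arity f) -> A) : 0 < e ->
    \sum_i q (Dist (a i) (b i)) < fsym_modulus f e ->
    q (Dist (App a) (App b)) <= e.
  apply: (state_dist_modulus qs) => M c e' e'0 H /=; exact: fun_respects H.
have h7 (P : psym L) (a : 'I_(psym_arity P) -> A) :
    psym_lo P <= q (Pred a) <= psym_hi P.
  by apply: (state_itv qs) => M c _; exact: pred_bounds.
have h8 (P : psym L) (e : R) (a b : 'I_(psym_arity P) -> A) : 0 < e ->
    \sum_i q (Dist (a i) (b i)) < psym_modulus P e ->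
    `|q (Pred a) - q (Pred b)| <= e.
  apply: (state_modulus_norm qs) => M c e' e'0 H /=; rewrite -mdist_realE.
  exact: pred_respects H.
exists (Prestructure (Var L hv_point) h1 h2 h3 h4 h5 h6 h7 h8).
by exists id => // a; exists a.
Qed.

(** The truth lemma of Henkin's method: by induction on formulas, evaluation at terms agrees with
    [q] after substitution. A supremum over the model is bounded by approximating points with terms,
    and is reached at a witness. *)
Lemma henkin_model : exists (M : structure L) (h : term L (hv L X) -> M),
  [/\ models M T,
      forall m (e : R), 0 < e -> exists t, mdist m (h t) <= e,
      forall t, term_eval (h \o Var L (X:=_)) t = h t &
      forall phi, eval (h \o Var L (X:=_)) phi = q phi].
Proof.
have [A [k ksurj [kd kf kP]]] := term_prestructure.
have [M [g [gd gdense gf gP]]] := prestructure_completion A.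
pose h := g \o k.
have hdense m (e : R) : 0 < e -> exists t, mdist m (h t) <= e.
  by move=> /(gdense m)[a]; have [t ->] := ksurj a; exists t.
have hterm Y (s : Y -> term L (hv L X)) (t : term L Y) :
    term_eval (h \o s) t = h (tsubst s t).
  elim: t => //= f ts IH; rewrite /h /= -kf -gf; congr fun_interp.
  by apply/funext => i; rewrite IH.
(* Separated from the induction because it is also applied to the negated body of an infimum. *)
have hsup Y (p : formula L (option Y)) :
    (forall s, eval (h \o s) p = q (subst s p)) ->
    forall s, eval (h \o s) (Sup p) = q (subst s (Sup p)).
  move=> IH s; have hoapp t : oapp (h \o s) (h t) = h \o oapp s t.
    by apply/funext => -[].
  have eval_oapp (N : structure L) (a : hv L X -> N) t : term_eval a \o oapp s t =
      oapp (term_eval a \o s) (term_eval a t) by apply/funext => -[].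
  apply/eqP; rewrite eq_le; apply/andP; split.
    apply: eval_Sup_le => b; apply: real_eps => e e0.
    have [r r0 Hr] := eval_unif_cont p e0.
    have [t bt] := hdense b r r0.
    have := Hr M (oapp (h \o s) b) (oapp (h \o s) (h t)).
    rewrite hoapp IH => H.
    have : q (subst (oapp s t) p) <= q (subst s (Sup p)).
      apply: (state_le qs) => N _ a; rewrite !eval_subst eval_oapp.
      exact: eval_Sup_ge.
    have : `|eval (oapp (h \o s) b) p - q (subst (oapp s t) p)| <= e.
      by apply: H => -[x|] //=; rewrite mdistxx ltW.
    by rewrite ler_norml => /andP[? ?] ?; lra.
  (* The substituted body may have infinitely many variables in its context; over a finite context
     it has a witness [w]. *)
  have [n [r [psi E]]] := body_finite_support (subst (slift s) p).
  have := qh.2 n psi r; set w := HWit psi r.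
  have -> : rename r (Sup psi) = subst s (Sup p).
    by rewrite /= E /rename /= slift_Var.
  have -> : q (rename (oapp r w) psi) = q (subst (oapp s (Var L w)) p).
    apply: (state_eq qs) => N a.
    rewrite eval_subst eval_oapp /= -term_eval_slift -eval_subst E !eval_rename.
    by congr (eval _ psi); apply/funext => -[].
  move/le_trans; apply; rewrite -IH -hoapp; exact: eval_Sup_ge.
have heval Y (p : formula L Y) s : eval (h \o s) p = q (subst s p).
  elim: p s => {Y}.
  - move=> Y P ts s /=; rewrite -kP -gP; congr pred_interp.
    by apply/funext => i; rewrite hterm.
  - by move=> Y t u s /=; rewrite !hterm gd kd.
  - by move=> Y s; rewrite (state_One qs).
  - by move=> Y p1 IH1 p2 IH2 s /=; rewrite (state_Add qs) IH1 IH2.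
  - by move=> Y c p IH s /=; rewrite (state_Scale qs) IH.
  - by move=> Y p IH s; exact: hsup.
  - move=> Y p IH s; rewrite eval_InfE hsup; last first.
      by move=> s' /=; rewrite (state_Scale qs) IH.
    rewrite -[LHS]mulN1r -(state_Scale qs); apply: (state_eq qs) => N a.
    transitivity (-1 * eval a (subst s (Sup (Scale (-1) p)))) => //.
    by rewrite mulN1r !eval_subst eval_InfE.
exists M, h; split=> //.
- move=> phi psi Tpp.
  have voidE (N : structure L) (a : void -> N) : of_void N = a by apply/funext => -[].
  rewrite (voidE M (h \o of_void (term L (hv L X)))) !heval.
  apply: (state_le qs) => N NT a; rewrite !eval_subst.
  by rewrite -(voidE N (_ \o _)); exact: NT.
- move=> t; rewrite hterm; congr h.
  by elim: t => //= f ts IH; congr App; apply/funext => i; exact: IH.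
- by move=> phi; rewrite heval; apply: (state_eq qs) => N a; rewrite eval_subst.
Qed.

End TermModel.

End Functionals.

(** * Compactness and extreme points in spaces of functions *)

Section Pointwise.
Context {R : realType} {W : Type}.
Implicit Types (F : set_system (W -> R)) (q : W -> R) (P : set (W -> R)).

Definition pcvg F q : Prop := forall w, p w @[p --> F] --> q w.

(** Closedness for the product topology in terms of filters, so that closed conditions come directly
    from limit rules for real numbers. *)
Definition pclosed P : Prop :=
  forall F q, ProperFilter F -> F P -> pcvg F q -> P q.

Definition pcont (f : (W -> R) -> R) : Prop :=
  forall F q, ProperFilter F -> pcvg F q -> f p @[p --> F] --> f q.

(** Tychonoff's theorem for a box: a refining ultrafilter converges in each coordinate, inside a
    compact interval. The limit is described by the closed conditions it inherits from [F]. *)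
Lemma pcompact F (b : W -> R) : ProperFilter F ->
  (forall w, F [set q | `|q w| <= b w]) ->
  exists q, forall P, pclosed P -> F P -> P q.
Proof.
move=> FF Fb; have [U [UU FU]] := ultraFilterLemma FF.
have lim w : exists l : R, p w @[p --> U] --> l.
  have Uw : (p w @[p --> U]) `[- b w, b w]%classic.
    apply: (@filterS _ U _ _ _ _ (FU _ (Fb w))) => q /=.
    by rewrite in_itv /= ler_norml.
  have [l [_ cl]] := @segment_compact R _ _ _ _ Uw.
  exists l => V Vl; have [//|UV] := in_ultra_setVsetC ((fun p => p w) @^-1` V) UU.
  by have [x []] := cl (~` V) V UV Vl.
exists (fun w => sval (cid (lim w))) => P Pc FP.
by apply: (Pc U) => [|w]; [exact: FU | exact: (svalP (cid (lim w)))].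
Qed.

Lemma pcont_eval w : pcont (fun q => q w).
Proof. by move=> F q FF; apply. Qed.

Lemma pcont_cst c : pcont (fun=> c).
Proof. by move=> F q FF _; exact: cvg_cst. Qed.

Lemma pcont_add f g : pcont f -> pcont g -> pcont (fun q => f q + g q).
Proof. by move=> cf cg F q FF Fq; apply: cvgD; [exact: cf | exact: cg]. Qed.

Lemma pcont_scale c f : pcont f -> pcont (fun q => c * f q).
Proof. by move=> cf F q FF Fq; apply: cvgM; [exact: cvg_cst | exact: cf]. Qed.

Lemma pcont_abs f : pcont f -> pcont (fun q => `|f q|).
Proof. by move=> cf F q FF Fq; apply: cvg_norm; exact: cf. Qed.

Lemma pclosed_le f g : pcont f -> pcont g -> pclosed [set q | f q <= g q].
Proof.
move=> cf cg F q FF FP Fq /=; rewrite -subr_ge0.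
apply: (@cvgr_to_ge _ F _ _ (fun p => g p - f p)).
  by apply: cvgB; [exact: cg | exact: cf].
by apply: (filterS _ FP) => p /=; rewrite subr_ge0.
Qed.

Lemma pclosed_eq f g : pcont f -> pcont g -> pclosed [set q | f q = g q].
Proof.
move=> cf cg F q FF FP Fq /=; apply/eqP; rewrite eq_le; apply/andP; split.
  by apply: (pclosed_le cf cg) Fq; apply: (filterS _ FP) => p /= ->.
by apply: (pclosed_le cg cf) Fq; apply: (filterS _ FP) => p /= ->.
Qed.

Lemma pclosed_and P1 P2 : pclosed P1 -> pclosed P2 -> pclosed (P1 `&` P2).
Proof.
move=> c1 c2 F q FF FP Fq; split.
  by apply: c1 Fq; apply: (filterS _ FP) => p [].
by apply: c2 Fq; apply: (filterS _ FP) => p [].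
Qed.

Lemma pclosed_forall (I : Type) (P : I -> set (W -> R)) :
  (forall i, pclosed (P i)) -> pclosed [set q | forall i, P i q].
Proof.
move=> c F q FF FP Fq i.
by apply: (c i) Fq; apply: (filterS _ FP) => p; exact.
Qed.

Lemma pclosed_imply (Q : Prop) P : pclosed P -> pclosed [set q | Q -> P q].
Proof.
move=> c F q FF FP Fq HQ.
by apply: c Fq; apply: (filterS _ FP) => p; exact.
Qed.

Definition mix (t : R) (q r : W -> R) : W -> R :=
  fun w => t * q w + (1 - t) * r w.

(* The extreme point is reached by successively maximizing coordinates: take a
   maximal set of equations [q w = r] cutting a nonempty face out of [K]. *)
Lemma extreme_point_exists (K : set (W -> R)) (b : W -> R) :
  K !=set0 -> pclosed K -> (forall q w, K q -> `|q w| <= b w) ->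
  exists2 q, K q & forall u v (t : R), K u -> K v -> 0 < t < 1 -> q = mix t u v ->
    u = q /\ v = q.
Proof.
move=> K0 Kc Kb.
pose S (A : set (W * R)) := [set q | K q /\ forall wr, A wr -> q wr.1 = wr.2].
pose face A := forall u v (t : R), K u -> K v -> 0 < t < 1 -> S A (mix t u v) ->
  S A u /\ S A v.
have Sc A : pclosed (S A).
  apply: pclosed_and => //; apply: pclosed_forall => wr.
  apply: pclosed_imply; apply: pclosed_eq; [exact: pcont_eval | exact: pcont_cst].
have [G Gch|A [[A0 Aface] Amax]] :=
    @Zorn_bigcup _ [set A | S A !=set0 /\ face A].
  (* Adjoining the empty set of equations keeps the filter base nonempty when the chain is empty. *)
  pose G' := [set A | A = set0 \/ G A].
  have G'ne A : G' A -> S A !=set0.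
    case=> [->|GA]; last by have [] := Gch _ GA.
    by have [q Kq] := K0; exists q; split.
  move=> Gtot; split.
    have FF : ProperFilter (filter_from G' S).
      apply: filter_from_proper => //; apply: filter_from_filter.
        by exists set0; left.
      have sub A A' : A `<=` A' -> S A' `<=` S A.
        by move=> AA' q [Kq H]; split=> // wr /AA'; exact: H.
      move=> A A' [->|GA] G'A'.
        by exists A' => //; rewrite subsetI; split => //; exact: sub.
      case: (G'A') => [->|GA'].
        by exists A; [right|rewrite subsetI; split => //; exact: sub].
      have [AA'|A'A] := Gtot _ _ GA GA'.
        by exists A'; [right|rewrite subsetI; split => //; exact: sub].
      by exists A; [right|rewrite subsetI; split => //; exact: sub].
    have [|q Hq] := @pcompact (filter_from G' S) b FF.
      by move=> w; exists set0; [left | move=> q [Kq _]; exact: Kb].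
    exists q; split; first by apply: Hq => //; exists set0; [left | move=> p []].
    move=> wr [A GA Awr].
    have [_] : S A q by apply: Hq => //; exists A => //; right.
    exact.
  move=> u v t Ku Kv t01 [Km Hm].
  have H A : G A -> S A u /\ S A v.
    move=> GA; have [_ Af] := Gch _ GA; apply: (Af u v t) => //.
    by split => // wr Awr; apply: Hm; exists A.
  by split; split=> // wr [A GA Awr]; have [[_ Hu] [_ Hv]] := H A GA;
    [exact: Hu | exact: Hv].
have Auniq p q : S A p -> S A q -> p = q.
  move=> Ap Aq; apply/funext => w; apply: contrapT => pq.
  pose E := [set p' w | p' in S A].
  have E0 : E !=set0 by exists (p w), p.
  have Eub : has_ubound E.
    by exists (b w) => _ [p' [Kp' _] <-]; exact: le_trans (ler_norm _) (Kb _ _ Kp').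
  (* The new equation puts the coordinate [w] at its supremum. Compactness makes the supremum
     attained, and a mixture with positive weights attains it only if both components do, so [A']
     again cuts out a nonempty face. *)
  pose r := sup E; pose A' := A `|` [set (w, r)].
  have rP p' : S A p' -> p' w <= r by move=> Ap'; apply: ub_le_sup => //; exists p'.
  apply: (Amax A').
    split; last by move=> AA'; apply: pq; have := AA' (w, r) (or_intror erefl);
      move=> Awr; rewrite (Ap.2 _ Awr) (Aq.2 _ Awr).
    by left.
  split.
    pose B (e : R) := [set p' | S A p' /\ r <= p' w + e].
    have FF : ProperFilter (filter_from [set e : R | 0 < e] B).
      apply: filter_from_proper; last first.
        move=> e e0; have [_ [p' Ap' <-] H] := sup_adherent e0 (conj E0 Eub).
        by exists p'; split=> //; rewrite -lerBlDr ltW.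
      apply: filter_from_filter; first by exists 1 => /=.
      move=> e e' e0 e'0; exists (Num.min e e'); first by rewrite /= lt_min; apply/andP.
      move=> p' [Ap' h]; split; split=> //; apply: le_trans h _; rewrite lerD2l.
        exact: minl_le.
      exact: minr_le.
    have [|p' Hp'] := @pcompact _ b FF.
      by move=> w'; exists 1 => //= p' [[Kp' _] _]; exact: Kb.
    have Ap' : S A p' by apply: Hp' => //; exists 1 => //= p'' [].
    exists p'; split; first by case: Ap'.
    move=> wr [|->/=]; first exact: Ap'.2.
    apply/eqP; rewrite eq_le rP//=; apply: real_eps => e e0.
    apply: (Hp' [set p' | r <= p' w + e]); last by exists e => // p'' [].
    apply: pclosed_le; first exact: pcont_cst.
    by apply: pcont_add; [exact: pcont_eval | exact: pcont_cst].
  move=> u v t Ku Kv t01 [Km Hm].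
  have [Au Av] : S A u /\ S A v.
    by apply: (Aface u v t) => //; split=> // wr Awr; apply: Hm; left.
  have /= := Hm (w, r) (or_intror erefl); rewrite /mix => Hr.
  have hu := rP _ Au; have hv := rP _ Av; case/andP: t01 => t0 t1.
  have [eu ev] : u w = r /\ v w = r by split; nra.
  split; split=> // wr [|->//=]; [exact: Au.2 | exact: Av.2].
have [q Aq] := A0; exists q; first by case: Aq.
move=> u v t Ku Kv t01 qE.
have [Au Av] : S A u /\ S A v by apply: (Aface u v t) => //; rewrite -qE.
by split; exact: Auniq.
Qed.

End Pointwise.

(** * Type spaces *)

Section TypeSpace.
Context {R : realType} {L : signature R} (T : theory L).

Definition pullback (X Y : Type) (r : X -> Y) (q : formula L Y -> R) :
    formula L X -> R^o := fun phi => q (rename r phi).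

Lemma state_bound (Y : Type) (q : formula L Y -> R) phi :
  state T q -> `|q phi| <= fbound phi.
Proof.
move=> qs; rewrite ler_norml; apply: (state_itv qs) => M a _.
by rewrite -ler_norml; exact: eval_bound.
Qed.

Lemma state_mix (Y : Type) (q r : formula L Y -> R) (t : R) : 0 <= t <= 1 ->
  state T q -> state T r -> state T (mix t q r).
Proof.
move=> /andP[t0 t1] qs rs; rewrite /mix; split.
- by rewrite (state_One qs) (state_One rs); lra.
- by move=> p1 p2; rewrite (state_Add qs) (state_Add rs); lra.
- by move=> c p; rewrite (state_Scale qs) (state_Scale rs); lra.
- move=> p1 p2 p12; have h1 := state_le qs p12; have h2 := state_le rs p12.
  by apply: lerD; apply: ler_wpM2l => //; rewrite subr_ge0.
Qed.

Lemma henkin_mix (X : Type) (q r : formula L (hv L X) -> R) (t : R) :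
  0 <= t <= 1 -> henkin T q -> henkin T r -> henkin T (mix t q r).
Proof.
move=> t01 [qs qw] [rs rw]; split; first exact: state_mix.
case/andP: t01 => t0 t1 n psi s; rewrite /mix.
by apply: lerD; apply: ler_wpM2l; rewrite ?subr_ge0.
Qed.

Lemma pclosed_state (Y : Type) : pclosed [set q : formula L Y -> R | state T q].
Proof.
move=> F q FF FP Fq; split.
- apply: (pclosed_eq (@pcont_eval _ _ _) (@pcont_cst _ _ _) FF) Fq.
  by apply: (filterS _ FP) => p ps; exact: (state_One ps).
- move=> p1 p2.
  apply: (pclosed_eq (@pcont_eval _ _ (Add p1 p2))
    (pcont_add (@pcont_eval _ _ p1) (@pcont_eval _ _ p2)) FF) Fq.
  by apply: (filterS _ FP) => p ps; exact: (state_Add ps _ _).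
- move=> c p1.
  have H : pclosed [set q : formula L Y -> R | q (Scale c p1) = c * q p1].
    by apply: pclosed_eq; [|apply: pcont_scale]; exact: pcont_eval.
  apply: (H F) Fq.
  by apply: (filterS _ FP) => p ps; exact: (state_Scale ps _ _).
- move=> p1 p2 p12.
  apply: (pclosed_le (@pcont_eval _ _ p1) (@pcont_eval _ _ p2) FF) Fq.
  by apply: (filterS _ FP) => p ps; exact: (state_le ps).
Qed.

Lemma pclosed_henkin (X : Type) :
  pclosed [set q : formula L (hv L X) -> R | henkin T q].
Proof.
apply: pclosed_and; first exact: pclosed_state.
apply: pclosed_forall => n; apply: pclosed_forall => psi.
apply: pclosed_forall => r.
by apply: pclosed_le; exact: pcont_eval.
Qed.

Lemma pclosed_pullback (X Y : Type) (r : X -> Y) (p : formula L X -> R^o) :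
  pclosed [set q : formula L Y -> R | pullback r q = p].
Proof.
move=> F q FF FP Fq; apply/funext => phi.
apply: (pclosed_eq (@pcont_eval _ _ (rename r phi)) (@pcont_cst _ _ (p phi)) FF) Fq.
by apply: (filterS _ FP) => q' /= <-.
Qed.

Lemma state_type (X : Type) p : type_space T X p -> state T p.
Proof. by case=> M [MT [a ->]]; exact: state_eval. Qed.

Lemma type_space_pullback (X Y : Type) (r : X -> Y) p :
  type_space T Y p -> type_space T X (pullback r p).
Proof.
case=> M [MT [a ->]]; exists M; split=> //; exists (a \o r).
by apply/funext => phi; rewrite /pullback /aff_type eval_rename.
Qed.

Lemma type_space_henkin (X : Type) q :
  henkin T q -> type_space T (hv L X) q.
Proof.
move=> qh; have [M [h [MT _ _ hq]]] := henkin_model qh.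
exists M; split=> //; exists (h \o Var L (X:=_)).
by apply/funext => phi; rewrite /aff_type hq.
Qed.

Section Witnesses.
Context {M : structure L} {X : Type} (a : X -> M)
  (pick : forall n, formula L (option 'I_n) -> ('I_n -> M) -> M).

Fixpoint hv_assign (x : hv L X) : M :=
  match x with
  | HBase x => a x
  | HWit n psi r => pick psi (fun i => hv_assign (r i))
  end.

End Witnesses.

(** A model of [p] provides witnesses only up to each [e > 0], its suprema need not be attained;
    compactness yields a limit with exact witnesses and the same restriction to [X]. *)
Lemma henkin_lift (X : Type) p : type_space T X p ->
  exists2 q, henkin T q & pullback (@HBase R L X) q = p.
Proof.
case=> M [MT [a ->]].
pose B (e : R) := [set q : formula L (hv L X) -> R | [/\ state T q,
  pullback (@HBase R L X) q = aff_type a &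
  forall (n : nat) (psi : formula L (option 'I_n)) r,
    q (rename r (Sup psi)) <= q (rename (oapp r (HWit psi r)) psi) + e]].
have FF : ProperFilter (filter_from [set e : R | 0 < e] B).
  apply: filter_from_proper; last first.
    move=> e /= e0.
    pose pick n (psi : formula L (option 'I_n)) b :=
      sval (cid (@eval_Sup_approx _ _ M _ b psi e e0)).
    exists (fun phi => eval (hv_assign a pick) phi); split.
    - exact: state_eval.
    - by apply/funext => phi; rewrite /pullback eval_rename.
    move=> n psi r; rewrite !eval_rename -lerBlDr.
    set b := hv_assign a pick \o r.
    have -> : hv_assign a pick \o oapp r (HWit psi r) = oapp b (pick n psi b).
      by apply/funext => -[].
    exact: (svalP (cid (eval_Sup_approx b psi e0))).
  apply: filter_from_filter; first by exists 1 => /=.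
  move=> e e' e0 e'0; exists (Num.min e e'); first by rewrite /= lt_min; apply/andP.
  have minE : Num.min e e' <= e /\ Num.min e e' <= e' by rewrite minl_le minr_le.
  move=> q [q1 q2 q3]; split; split=> // n psi r; apply: le_trans (q3 n psi r) _;
    by rewrite lerD2l; case: minE.
have [|q Hq] := @pcompact _ _ _ (@fbound R L (hv L X)) FF.
  by move=> phi; exists 1 => //= q [qs _ _]; exact: state_bound.
exists q; first split.
- by apply: Hq; [exact: pclosed_state | exists 1 => //= q' []].
- move=> n psi r; apply: real_eps => e e0.
  apply: (Hq [set q | q (rename r (Sup psi)) <=
      q (rename (oapp r (HWit psi r)) psi) + e]).
    apply: pclosed_le; first exact: pcont_eval.
    by apply: pcont_add; [exact: pcont_eval | exact: pcont_cst].
  by exists e => // q' [_ _]; exact.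
- have H := Hq _ (pclosed_pullback (r := @HBase R L X) (p := aff_type a)).
  by apply: H; exists 1 => //= q' [].
Qed.

Lemma pullback_mix (X Y : Type) (r : X -> Y) (q q' : formula L Y -> R) t :
  pullback r (mix t q q') = mix t (pullback r q) (pullback r q').
Proof. by []. Qed.

(** Two types may come from unrelated models, with no evident model for their mixture; Henkin
    conditions survive mixing, and a Henkin state builds its own model. *)
Lemma type_space_convex (X : Type) (u v : formula L X -> R^o) (t : R) :
  0 <= t <= 1 -> type_space T X u -> type_space T X v ->
  type_space T X (mix t u v).
Proof.
move=> t01 /henkin_lift[q qh <-] /henkin_lift[r rh <-].
rewrite -pullback_mix; apply: type_space_pullback.
by apply: type_space_henkin; exact: henkin_mix.
Qed.

(** A choice of Henkin lifts carries the filter to Henkin states, where compactness gives a limit;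
    this limit restricts to [p]. *)
Lemma type_space_closed (X : Type) :
  pclosed (type_space T X : set (formula L X -> R)).
Proof.
move=> F p FF FS Fp.
have lift u : exists q, type_space T X u ->
    henkin T q /\ pullback (@HBase R L X) q = u.
  have [/henkin_lift[q qh qu]|nu] := pselect (type_space T X u).
    by exists q.
  by exists (fun=> 0) => /nu.
pose l u := sval (cid (lift u)).
have lP u : type_space T X u ->
    henkin T (l u) /\ pullback (@HBase R L X) (l u) = u.
  exact: (svalP (cid (lift u))).
have [|q Hq] := @pcompact _ _ (l u @[u --> F]) (@fbound R L (hv L X)) _.
  move=> phi; have : F [set u | `|l u phi| <= fbound phi]; last by [].
  by apply: (filterS _ FS) => u /lP[[ls _] _]; exact: state_bound ls.
suff -> : p = pullback (@HBase R L X) q.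
  apply/type_space_pullback/type_space_henkin.
  apply: (Hq _ (@pclosed_henkin X)).
  have : F [set u | henkin T (l u)]; last by [].
  by apply: (filterS _ FS) => u /lP[].
apply/funext => phi; apply/eqP; rewrite eq_sym -subr_eq0 -normr_le0.
apply: real_eps => e e0; rewrite add0r.
apply: (Hq [set q | `|q (rename (@HBase R L X) phi) + - p phi| <= e]).
  apply: pclosed_le; last exact: pcont_cst.
  apply: pcont_abs; apply: (@pcont_add _ _ (fun q => q _) (fun=> _)).
    exact: pcont_eval.
  exact: pcont_cst.
have : F [set u | `|p phi - u phi| <= e].
  by have /cvgr_dist_le H := Fp phi; exact: H.
move=> Fe; have : F [set u |
    `|l u (rename (@HBase R L X) phi) + - p phi| <= e]; last by [].
apply: (filterS _ (filterI FS Fe)) => u [/lP[_ lu]] /=.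
by rewrite -/(pullback (@HBase R L X) (l u) phi) lu distrC.
Qed.

End TypeSpace.

(** * Suprema over fibers of the restriction of types *)

Section Lifting.
Context {R : realType} {L : signature R} (T : theory L) {Y W : Type}.

Definition sumf (A : Type) (b : Y -> A) (w : W -> A) (z : Y + W) : A :=
  match z with inl y => b y | inr x => w x end.

Let agree (M : Type) (ws : seq W) (a a' : Y + W -> M) : Prop :=
  forall z, (forall w, List.In w ws -> z <> inr w) -> a' z = a z.

(** The listed variables are quantified one by one, [el] turning each into the bound variable.
    Suprema are only approached, so each quantifier takes half of the error. *)
Lemma sup_out_list (ws : seq W) (phi : formula L (Y + W)) :
  exists phi' : formula L (Y + W), forall (M : structure L) (a : Y + W -> M),
    (forall a', agree ws a a' -> eval a' phi <= eval a phi') /\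
    (forall e : R, 0 < e -> exists2 a', agree ws a a' &
       eval a phi' <= eval a' phi + e).
Proof.
elim: ws => [|w ws [phi' IH]].
  exists phi => M a; split=> [a' aa'|e e0]; last by exists a => //; rewrite lerDl ltW.
  by rewrite (_ : a' = a)//; apply/funext => z; exact: aa'.
pose el (z : Y + W) := if `[< z = inr w >] then None else Some z.
exists (Sup (rename el phi')) => M a; split=> [a' aa'|e e0].
  have := eval_Sup_ge a (rename el phi') (a' (inr w)).
  rewrite eval_rename; apply: le_trans.
  have [+ _] := IH M (oapp a (a' (inr w)) \o el); apply=> z zws /=.
  rewrite /el; case: asboolP => [->//|zw] /=.
  by apply: aa' => w' /= [<-//|]; exact: zws.
have e20 : 0 < e / 2 by rewrite divr_gt0.
have [b] := eval_Sup_approx a (rename el phi') e20.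
rewrite eval_rename => Hb.
have [_ /(_ _ e20)[a' aa' Ha']] := IH M (oapp a b \o el).
exists a'; last lra.
move=> z zws; rewrite aa' /=; last by move=> w' ww'; apply: zws; right.
rewrite /el; case: asboolP => [zw|//].
by case: (zws w _ zw); left.
Qed.

(** Only finitely many variables of [W] occur in [phi], and these are quantified out. A last
    quantifier binds all of [W] merged into one dummy variable, which leaves a formula over [Y]. *)
Lemma sup_out (phi : formula L (Y + W)) :
  exists psi : formula L Y, forall (M : structure L) (b : Y -> M),
    (forall w, eval (sumf b w) phi <= eval b psi) /\
    (forall e : R, 0 < e -> exists w, eval b psi <= eval (sumf b w) phi + e).
Proof.
have [n [r [phi0 phiE]]] := formula_finite_support phi.
pose ws := pmap (fun i => if r i is inr w then Some w else None) (enum 'I_n).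
have wsP i w : r i = inr w -> List.In w ws.
  move=> riw; have : i \in enum 'I_n by rewrite mem_enum.
  rewrite /ws; elim: (enum 'I_n) => //= j l IH; rewrite inE => /orP[/eqP <-|il].
    by rewrite riw /=; left.
  by case: (r j) => [y|w'] /=; [|right]; exact: IH.
have [phi' Hphi'] := sup_out_list ws phi.
pose el (z : Y + W) := if z is inl y then Some y else None.
have elE (M : structure L) (b : Y -> M) c : oapp b c \o el = sumf b (fun=> c).
  by apply/funext => -[].
exists (Sup (rename el phi')) => M b; split=> [w|e e0].
  have [c _] := carrier_nonempty M.
  have := eval_Sup_ge b (rename el phi') c; rewrite eval_rename elE.
  apply: le_trans.
  pose w' x := if `[< List.In x ws >] then w x else c.
  have -> : eval (sumf b w) phi = eval (sumf b w') phi.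
    rewrite phiE !eval_rename; congr (eval _ phi0); apply/funext => i /=.
    case E : (r i) => [//|x] /=; rewrite /w'; case: asboolP => // nx.
    by case: nx; exact: wsP E.
  have [+ _] := Hphi' M (sumf b (fun=> c)); apply=> -[//|x] xws /=.
  by rewrite /w'; case: asboolP => // /xws.
have e20 : 0 < e / 2 by rewrite divr_gt0.
have [c] := eval_Sup_approx b (rename el phi') e20.
rewrite eval_rename elE => Hc.
have [_ /(_ _ e20)[a' aa' Ha']] := Hphi' M (sumf b (fun=> c)).
exists (a' \o inr).
have -> : sumf b (a' \o inr) = a'.
  by apply/funext => -[y|//] /=; rewrite aa'.
lra.
Qed.

(** The bound holds for [s] realized in any model, since [psi] is evaluated at the restriction of
    [s]; a near-maximizer over [u] is found in whichever model realizes [u]. *)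
Lemma type_space_sup (phi : formula L (Y + W)) :
  exists psi : formula L Y,
    (forall s, type_space T (Y + W) s -> s phi <= pullback inl s psi) /\
    (forall u (e : R), 0 < e -> type_space T Y u -> exists s,
       [/\ type_space T (Y + W) s, pullback inl s = u & u psi <= s phi + e]).
Proof.
have [psi Hpsi] := sup_out phi; exists psi; split.
  move=> s [M [MT [a ->]]]; rewrite /pullback /aff_type eval_rename.
  have [+ _] := Hpsi M (a \o inl); move/(_ (a \o inr)).
  by rewrite (_ : sumf _ _ = a)//; apply/funext => -[].
move=> u e e0 [M [MT [b ->]]].
have [_ /(_ _ e0)[w Hw]] := Hpsi M b.
exists (aff_type (sumf b w)); split=> //; first by exists M; split=> //; exists (sumf b w).
by apply/funext => p; rewrite /pullback /aff_type eval_rename.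
Qed.

(* [d] is a squared distance to a convex set; [tau] is the fraction of the way
   moved towards a point that maximizes, up to [eta], the functional separating
   the target from the current point. *)
Lemma small_of_decrease (E : set R) (C : R) : E !=set0 -> 0 <= C ->
  (forall d, E d -> 0 <= d) ->
  (forall d tau eta : R, E d -> 0 < tau <= 1 -> 0 < eta -> exists2 d', E d' &
     d' <= (1 - tau) ^+ 2 * d + 2 * tau * eta + tau ^+ 2 * C) ->
  forall e : R, 0 < e -> exists2 d, E d & d <= e.
Proof.
move=> E0 C0 Epos dec e e0; apply: contrapT => H.
have lbE : lbound E e.
  by move=> d Ed; rewrite leNgt; apply/negP => de; apply: H; exists d => //; exact: ltW.
pose I := inf E.
have Ie : e <= I by exact: lb_le_inf.
have I0 : 0 < I by exact: lt_le_trans Ie.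
have hE : has_inf E by split=> //; exists e.
(* With [d < I + tau ^+ 2] and [eta = tau], a step to [d' >= I] would force
   [2 * tau * I <= tau ^+ 2 * N]: the 3 counts one [tau ^+ 2] from the choice of [d] and two from
   [eta]. The choice of [tau] makes the right side [tau * I], which is too small. *)
pose N := I + 3 + C; have N0 : 0 < N by rewrite /N; lra.
pose tau := I / N.
have tN : tau * N = I by rewrite /tau divfK// gt_eqF.
have tau0 : 0 < tau by rewrite divr_gt0.
have tau1 : tau <= 1 by rewrite ler_pdivrMr// mul1r /N; lra.
have [d Ed dI] := inf_adherent (exprn_gt0 2 tau0) hE.
have [|d' Ed' Hd'] := dec d tau tau Ed _ tau0; first by rewrite tau0.
have : I <= d' by apply: ge_inf => //; exists e.
have : 0 <= d by exact: Epos.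
rewrite -/I in dI; rewrite /N in tN.
clearbody I tau; clear -tau0 tau1 tN dI Hd' I0 C0.
move=> d0 Id'.
have h1 : (1 - tau) ^+ 2 * d <= (1 - tau) ^+ 2 * (I + tau ^+ 2).
  by apply: ler_wpM2l; [exact: sqr_ge0 | exact: ltW].
have h2 : (1 - tau) ^+ 2 * tau ^+ 2 <= tau ^+ 2.
  rewrite -[leRHS]mul1r; apply: ler_wpM2r; first exact: sqr_ge0.
  by rewrite expr_le1//; lra.
have h3 : 2 * tau * I <= tau * (tau * (I + 3 + C)).
  by move: Id' Hd' h1 h2; rewrite !expr2; nra.
rewrite tN in h3; have : 0 < tau * I by rewrite mulr_gt0.
by lra.
Qed.

End Lifting.

(** * Lifting convex decompositions *)

Section Lift.
Context {R : realType} {L : signature R} (T : theory L) {Y W : Type}.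
Context (s : formula L (Y + W) -> R^o) (u v : formula L Y -> R^o) (t : R).
Hypothesis t01 : 0 <= t <= 1.
Hypothesis Ts : type_space T (Y + W) s.
Hypothesis Tu : type_space T Y u.
Hypothesis Tv : type_space T Y v.
Hypothesis suv : pullback inl s = mix t u v.

Let over (p : formula L Y -> R^o) (p' : formula L (Y + W) -> R^o) : Prop :=
  type_space T (Y + W) p' /\ pullback inl p' = p.

Let over_mix p p1 p2 (c : R) : 0 <= c <= 1 -> over p p1 -> over p p2 ->
  over p (mix c p1 p2).
Proof.
move=> c01 [T1 e1] [T2 e2]; split; first exact: type_space_convex.
rewrite pullback_mix e1 e2; apply/funext => phi; rewrite /mix.
by rewrite -mulrDl addrC subrK mul1r.
Qed.

(* The point of the fiber nearest to [s] on the coordinates in [l] is at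
   distance 0: otherwise the direction towards [s] is a formula separating [s]
   from the fiber, whose supremum over the extra variables is again a formula,
   and the latter is affine along [t u + (1 - t) v]. *)
Lemma approx_lift (l : seq (formula L (Y + W))) (e : R) : 0 < e ->
  exists u' v', [/\ over u u', over v v' &
    \sum_(phi <- l) (s phi - mix t u' v' phi) ^+ 2 <= e].
Proof.
move=> e0.
pose D (p : _ * _) := \sum_(phi <- l) (s phi - mix t p.1 p.2 phi) ^+ 2.
pose E := [set d | exists u' v', [/\ over u u', over v v' & d = D (u', v')]].
pose C := \sum_(phi <- l) (2 * fbound phi) ^+ 2.
suff [d [u' [v' [ou ov ->]]] Hd] : exists2 d, E d & d <= e by exists u', v'.
apply: (@small_of_decrease R E C) e0.
(* The formula [One] serves to produce a point in each of the two fibers. *)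
- have [psi [_ H]] := type_space_sup T (One L (Y + W)).
  have [u' [? ? _]] := H u 1 ltr01 Tu; have [v' [? ? _]] := H v 1 ltr01 Tv.
  by exists (D (u', v')), u', v'.
- by apply: sumr_ge0 => phi _; exact: sqr_ge0.
- by move=> _ [u' [v' [_ _ ->]]]; apply: sumr_ge0 => phi _; exact: sqr_ge0.
move=> _ tau eta [u0 [v0 [ou0 ov0 ->]]] /andP[tau0 tau1] eta0.
pose r0 phi := s phi - mix t u0 v0 phi.
pose psi := fsum [seq Scale (r0 phi) phi | phi <- l].
have psiE q : state T q -> q psi = \sum_(phi <- l) r0 phi * q phi.
  move=> qs; rewrite (state_fsum qs) big_map; apply: eq_bigr => phi _.
  exact: state_Scale qs _ _.
have [Psi [Hs Hext]] := type_space_sup T psi.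
have [u1 [Tu1 eu1 Hu1]] := Hext u eta eta0 Tu.
have [v1 [Tv1 ev1 Hv1]] := Hext v eta eta0 Tv.
have T1 : type_space T (Y + W) (mix t u1 v1) by exact: type_space_convex.
pose r1 phi := s phi - mix t u1 v1 phi.
(* This compares [s psi] with its bound [t * u Psi + (1 - t) * v Psi], which [u1] and [v1] attain up
   to [eta]. *)
have r01 : \sum_(phi <- l) r0 phi * r1 phi <= eta.
  have -> : \sum_(phi <- l) r0 phi * r1 phi = s psi - mix t u1 v1 psi.
    rewrite (psiE _ (state_type Ts)) (psiE _ (state_type T1)) -sumrB.
    by apply: eq_bigr => phi _; rewrite mulrBr.
  have := Hs _ Ts; rewrite suv /mix => h.
  case/andP: t01 => t0 t1.
  have := ler_wpM2l t0 Hu1; have := ler_wpM2l (_ : 0 <= 1 - t) Hv1.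
  rewrite subr_ge0 => /(_ t1) h1 h2.
  rewrite !mulrDr in h1 h2; lra.
have r11 : \sum_(phi <- l) r1 phi ^+ 2 <= C.
  apply: ler_sum => phi _; rewrite -ler_sqrt ?sqr_ge0//.
  rewrite !sqrtr_sqr; apply: le_trans (ler_normB _ _) _.
  rewrite (_ : 2 * fbound phi = fbound phi + fbound phi); last lra.
  apply: le_trans (ler_norm _).
  apply: lerD; first exact: state_bound (state_type Ts).
  exact: state_bound (state_type T1).
have tau01 : 0 <= 1 - tau <= 1 by apply/andP; split; lra.
exists (D (mix (1 - tau) u0 u1, mix (1 - tau) v0 v1)).
  exists (mix (1 - tau) u0 u1), (mix (1 - tau) v0 v1); split=> //.
    exact: over_mix tau01 ou0 (conj Tu1 eu1).
  exact: over_mix tau01 ov0 (conj Tv1 ev1).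
have -> : D (mix (1 - tau) u0 u1, mix (1 - tau) v0 v1) =
    (1 - tau) ^+ 2 * D (u0, v0) +
    2 * (1 - tau) * tau * \sum_(phi <- l) r0 phi * r1 phi +
    tau ^+ 2 * \sum_(phi <- l) r1 phi ^+ 2.
  rewrite /D !mulr_sumr -!big_split /=; apply: eq_bigr => phi _.
  by rewrite /r0 /r1 /mix; ring.
apply: lerD; last by apply: ler_wpM2l => //; exact: sqr_ge0.
rewrite lerD2l -!mulrA; apply: ler_wpM2l => //.
apply: le_trans (_ : (1 - tau) * (tau * eta) <= _).
  apply: ler_wpM2l; first by case/andP: tau01.
  by apply: ler_wpM2l => //; exact: ltW.
by rewrite -[leRHS]mul1r; apply: ler_wpM2r; [apply: mulr_ge0; exact: ltW | lra].
Qed.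

Lemma pclosed_comp (A B : Type) (f : A -> B) (P : set (A -> R)) :
  pclosed P -> pclosed [set q : B -> R | P (q \o f)].
Proof.
move=> Pc F q FF FP Fq /=.
apply: (Pc (fmap (fun q' : B -> R => q' \o f) F)) => // a; exact: Fq.
Qed.

(** Compactness turns approximate lifts on finite lists of formulas into an exact one. The pair
    [(u', v')] is coded as one function on [bool * formula], so that both components converge
    together. *)
Lemma type_lift : exists u' v', [/\ type_space T (Y + W) u',
  type_space T (Y + W) v', pullback inl u' = u, pullback inl v' = v &
  s = mix t u' v'].
Proof.
pose pr (i : bool) (q : bool * formula L (Y + W) -> R) :
  formula L (Y + W) -> R^o := q \o pair i.
pose B (le : seq (formula L (Y + W)) * R) :=
  [set q | [/\ over u (pr true q), over v (pr false q) &
    forall phi, List.In phi le.1 ->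
      `|s phi - mix t (pr true q) (pr false q) phi| <= le.2]].
have FF : ProperFilter (filter_from [set le | 0 < le.2] B).
  apply: filter_from_proper; last first.
    move=> [l e] /= e0.
    have [u' [v' [ou ov H]]] := approx_lift l (exprn_gt0 2 e0).
    exists (fun ip => if ip.1 then u' ip.2 else v' ip.2); split=> // phi lphi.
    rewrite /pr /=.
    have : (s phi - mix t u' v' phi) ^+ 2 <= e ^+ 2.
      apply: le_trans H; move: lphi.
      elim: (l : seq _) => //= p l' IH [->|/IH]; rewrite big_cons.
        by rewrite lerDl; apply: sumr_ge0 => p' _; exact: sqr_ge0.
      by move/le_trans; apply; rewrite lerDr sqr_ge0.
    rewrite -ler_sqrt ?exprn_ge0 ?(ltW e0)// !sqrtr_sqr.
    by rewrite (ger0_norm (ltW e0)).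
  apply: filter_from_filter; first by exists ([::], 1) => /=.
  move=> [l e] [l' e'] /= e0 e'0; exists (l ++ l', Num.min e e').
    by rewrite /= lt_min; apply/andP.
  move=> q [q1 q2 q3]; split; split=> // phi lphi; apply: le_trans (q3 phi _) _ => /=.
  - by apply: List.in_or_app; left.
  - exact: minl_le.
  - by apply: List.in_or_app; right.
  - exact: minr_le.
have [|q Hq] := @pcompact _ _ _ (fun ip => fbound ip.2) FF.
  move=> [i phi]; exists ([::], 1) => //= q [[q1 _] [q2 _] _].
  by case: i; [exact: (state_bound phi (state_type q1)) |
               exact: (state_bound phi (state_type q2))].
have over_closed p i : pclosed [set q | over p (pr i q)].
  apply: pclosed_and.
    exact: (pclosed_comp (f := pair i) (@type_space_closed R L T (Y + W))).
  exact: (pclosed_comp (f := pair i) (pclosed_pullback (r := inl) (p := p))).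
have [Tu' eu'] : over u (pr true q).
  by apply: (Hq _ (over_closed u true)); exists ([::], 1) => //= q' [].
have [Tv' ev'] : over v (pr false q).
  by apply: (Hq _ (over_closed v false)); exists ([::], 1) => //= q' [].
exists (pr true q), (pr false q); split=> //.
apply/funext => phi; apply/eqP; rewrite -subr_eq0 -normr_le0.
apply: real_eps => e e0; rewrite add0r.
rewrite -[X in s phi + X]mulN1r.
apply: (Hq [set q | `|s phi + -1 * (t * q (true, phi) + (1 - t) * q (false, phi))| <= e]).
  apply: pclosed_le; last exact: pcont_cst.
  apply: pcont_abs; apply: (@pcont_add _ _ (fun=> _) (fun q => _ * _)).
    exact: pcont_cst.
  apply: pcont_scale; apply: (@pcont_add _ _ (fun q => _ * _) (fun q => _ * _)).
    by apply: pcont_scale; exact: pcont_eval.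
  by apply: pcont_scale; exact: pcont_eval.
exists ([:: phi], e) => //= q' [_ _ H].
have := H phi (or_introl erefl).
by rewrite -[X in s phi + X]mulN1r.
Qed.

End Lift.

(** * Extremal models *)

Section Main.
Context {R : realType} {L : signature R} (T : theory L).

(** A formula has finitely many variables, so a decomposition can be tested on finite subtuples,
    whose types are extreme by definition. *)
Lemma extremal_realizes_extreme (X : Type) (M : structure L) (a : X -> M) :
  extremal_model T M -> extreme_types T X (aff_type a).
Proof.
move=> [MT Mext]; split; first by exists M; split=> //; exists a.
move=> q r t Tq Tr t01 pE.
suff H phi : q phi = eval a phi /\ r phi = eval a phi.
  by split; apply/funext => phi; have [] := H phi.
have [n [f [phi0 ->]]] := formula_finite_support phi.
have [_ Hext] := Mext n (a \o f).
have [||||qE rE] := Hext (pullback f q) (pullback f r) t.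
- exact: type_space_pullback.
- exact: type_space_pullback.
- exact: t01.
- apply/funext => psi; rewrite /aff_type -eval_rename.
  exact: (congr1 (fun p => p (rename f psi)) pE).
by rewrite eval_rename -/(aff_type (a \o f) phi0) -{1}qE -rE.
Qed.

(** The Henkin condition is the equality case of an inequality valid in all types; with positive
    weights, equality for the mixture forces equality for both components. *)
Lemma henkin_face (X : Type) (q u v : formula L (hv L X) -> R^o) (t : R) :
  henkin T q -> 0 < t < 1 -> type_space T (hv L X) u ->
  type_space T (hv L X) v -> q = mix t u v -> henkin T u /\ henkin T v.
Proof.
move=> [_ qw] /andP[t0 t1] Tu Tv qE.
have us := state_type Tu; have vs := state_type Tv.
have H n (psi : formula L (option 'I_n)) r :
    let w := rename (oapp r (HWit psi r)) psi in
    u (rename r (Sup psi)) <= u w /\ v (rename r (Sup psi)) <= v w.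
  move=> w; have := qw n psi r; rewrite -/w qE /mix.
  have le : tle T w (rename r (Sup psi)).
    move=> M _ a; rewrite !eval_rename.
    rewrite (_ : a \o _ = oapp (a \o r) (a (HWit psi r))); last first.
      by apply/funext => -[].
    exact: eval_Sup_ge.
  have := state_le us le; have := state_le vs le.
  by split; nra.
by split; split=> // n psi r; have [] := H n psi r.
Qed.

(* Distances being nonnegative, each component of a decomposition of the type of
   [(a, c)] still puts [a i] near the terms in [c] that approximate it. *)
Lemma closure_extreme (Y Z : Type) (M : structure L) (a : Y -> M) (c : Z -> M)
    (u v : formula L (Y + Z) -> R^o) (t : R) :
  (forall i (e : R), 0 < e -> exists tm, mdist (a i) (term_eval c tm) <= e) ->
  0 < t < 1 -> type_space T (Y + Z) u -> type_space T (Y + Z) v ->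
  aff_type (sumf a c) = mix t u v ->
  pullback inr u = aff_type c -> u = aff_type (sumf a c).
Proof.
move=> dense /andP[t0 t1] [N [NT [b ->]]] Tv aE bc.
apply/funext => phi; apply/eqP; rewrite -subr_eq0 -normr_le0.
apply: real_eps => e e0; rewrite add0r.
have e20 : 0 < e / 2 by rewrite divr_gt0.
have [r r0 Hr] := eval_unif_cont phi e20.
(* The component [u] has weight [t]: discarding the nonnegative contribution of [v] turns the bound
   [t * r] into [r] for [u]. *)
have rt0 : 0 < t * r by rewrite mulr_gt0.
pose tm i := sval (cid (dense i _ rt0)).
have tmP i : mdist (a i) (term_eval c (tm i)) <= t * r.
  exact: (svalP (cid (dense i _ rt0))).
(* Replacing each variable of [Y] by its approximating term makes [phi] a formula over [Z], on which
   the two types agree. *)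
pose sub (z : Y + Z) := match z with inl i => tm i | inr x => Var L x end.
have bcE (psi : formula L Z) : eval (b \o inr) psi = eval c psi.
  by rewrite -eval_rename; exact: (congr1 (fun p => p psi) bc).
have tsubE (N' : structure L) (b' : Y + Z -> N') tm' :
    term_eval b' (tsubst (fun x => Var L (inr x)) tm') =
    term_eval (b' \o inr) tm' by rewrite term_eval_tsubst.
have close i : mdist (b (inl i)) (term_eval (b \o inr) (tm i)) <= r.
  pose d := Dist (Var L (inl i)) (tsubst (fun x => Var L (inr x)) (tm i)) :
    formula L (Y + Z).
  have := congr1 (fun p => p d) aE; rewrite /mix /aff_type /= !tsubE /=.
  rewrite (_ : sumf a c \o inr = c); last by apply/funext.
  have : 0 <= v d.
    have [N' [_ [b' ->]]] := Tv; exact: mdist_ge0.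
  have := tmP i; set x := mdist _ _; set y := v d.
  move=> h1 h2 h3; have : t * (mdist (b (inl i)) (term_eval (b \o inr) (tm i))) <= t * r.
    have : 0 <= (1 - t) * y by rewrite mulr_ge0// subr_ge0 ltW.
    by lra.
  by rewrite ler_pM2l.
have hN : `|eval b phi - eval (b \o inr) (subst sub phi)| <= e / 2.
  rewrite eval_subst; apply: Hr => -[i|x] /=; first exact: close.
  by rewrite mdistxx ltW.
have hM : `|eval (sumf a c) phi - eval c (subst sub phi)| <= e / 2.
  rewrite eval_subst; apply: Hr => -[i|x] /=; last by rewrite mdistxx ltW.
  apply: le_trans (tmP i) _; rewrite -[leRHS]mul1r.
  by apply: ler_wpM2r; exact: ltW.
rewrite bcE in hN; rewrite /aff_type.
move: hN hM; rewrite !ler_norml => /andP[? ?] /andP[? ?].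
by apply/andP; split; lra.
Qed.

Lemma extreme_realized_in_extremal (X : Type) (p : formula L X -> R^o) :
  extreme_types T X p ->
  exists M : structure L, extremal_model T M /\ exists a : X -> M, p = aff_type a.
Proof.
move=> [Tp pext].
pose K := [set q | henkin T q /\ pullback (@HBase R L X) q = p].
have K0 : K !=set0 by have [q qh qp] := henkin_lift Tp; exists q.
have Kc : pclosed K.
  by apply: pclosed_and; [exact: pclosed_henkin | exact: pclosed_pullback].
have Kb q phi : K q -> `|q phi| <= fbound phi.
  by case=> -[qs _] _; exact: state_bound qs.
have [q [qh qp] qext] := extreme_point_exists K0 Kc Kb.
have [M [h [MT hdense hterm hq]]] := henkin_model qh.
pose c := h \o Var L (X:=_).
have cq : aff_type c = q by apply/funext => phi; exact: hq.
(* So far [q] is extreme only among Henkin states over [p]; extremality of [p] forces the components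
   of any Henkin decomposition to lie over [p]. *)
have qext' u v (t : R) : henkin T u -> henkin T v -> 0 < t < 1 ->
    q = mix t u v -> u = q /\ v = q.
  move=> uh vh t01 qE.
  have [up vp] : pullback (@HBase R L X) u = p /\ pullback (@HBase R L X) v = p.
    apply: (pext _ _ t) => //.
    - exact/type_space_pullback/type_space_henkin.
    - exact/type_space_pullback/type_space_henkin.
    - by rewrite -qp qE.
  exact: (qext u v t).
exists M; split; last first.
  exists (c \o @HBase R L X); rewrite -qp; apply/funext => phi.
  by rewrite /pullback -hq /aff_type eval_rename.
split=> // n a; split; first by exists M; split=> //; exists a.
move=> u v t Tu Tv t01 aE.
have t01' : 0 <= t <= 1 by case/andP: t01 => ? ?; apply/andP; split; exact: ltW.
have Ts : type_space T ('I_n + hv L X) (aff_type (sumf a c)).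
  by exists M; split=> //; exists (sumf a c).
have suv : pullback inl (aff_type (sumf a c)) = mix t u v.
  rewrite -[RHS]/(t *: u + (1 - t) *: v) -aE; apply/funext => phi.
  by rewrite /pullback /aff_type eval_rename.
have [u' [v' [Tu' Tv' eu ev sE]]] := type_lift t01' Ts Tu Tv suv.
have sr : pullback inr (aff_type (sumf a c)) = q.
  by rewrite -cq; apply/funext => phi; rewrite /pullback /aff_type eval_rename.
have qE : q = mix t (pullback inr u') (pullback inr v') by rewrite -sr sE.
have Tru : type_space T (hv L X) (pullback inr u') by exact: type_space_pullback.
have Trv : type_space T (hv L X) (pullback inr v') by exact: type_space_pullback.
have [uh vh] := henkin_face qh t01 Tru Trv qE.
have [uq vq] := qext' _ _ _ uh vh t01 qE.
have dense i (e : R) : 0 < e -> exists tm, mdist (a i) (term_eval c tm) <= e.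
  by move=> /(hdense (a i))[tm Htm]; exists tm; rewrite hterm.
have u'E : u' = aff_type (sumf a c).
  by apply: (closure_extreme dense t01 Tu' Tv' sE); rewrite uq cq.
have v'E : v' = aff_type (sumf a c).
  apply: (@closure_extreme _ _ M a c v' u' (1 - t) dense _ Tv' Tu').
  - by case/andP: t01 => ? ?; apply/andP; split; lra.
  - rewrite sE; apply/funext => phi; rewrite /mix; lra.
  - by rewrite vq cq.
have inlE : pullback inl (aff_type (sumf a c)) = aff_type a.
  by apply/funext => phi; rewrite /pullback /aff_type eval_rename.
by rewrite -eu -ev u'E v'E inlE.
Qed.

End Main.

Theorem theorem5p10 (R : realType) (L : signature R) (T : theory L) (X : Type) :
  (forall p : formula L X -> R^o, type_space T X p ->
     (extreme_types T X p <->
      exists M : structure L, extremal_model T M /\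
        exists a : X -> M, p = aff_type a)) /\
  extreme_types T X =
    [set p | exists M : structure L, extremal_model T M /\
       exists a : X -> M, p = aff_type a].
Proof.
have H p : extreme_types T X p <->
    exists M : structure L, extremal_model T M /\
      exists a : X -> M, p = aff_type a.
  split; first exact: extreme_realized_in_extremal.
  by case=> M [Mext [a ->]]; exact: extremal_realizes_extreme.
by split=> //; apply/seteqP; split=> p /H.
Qed.
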